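(* Let $\beta\in\{1,2,4\}$, $n\ge1$, and let $\mathbf P_1$ be a random orthogonal projection in $\mathbb{H}_{n,\beta}$ of trace $1$ whose law is rotation invariant. Then for $\theta\in\mathbb{H}_{n,\beta}$, $L_n(\theta)=\mathbb{E}e^{\langle\theta|\mathbf P_1\rangle}$ has the series expansion $$L_n(\theta)=\sum_{k=0}^\infty\frac{(-1)^k}{\left(\frac{n\beta}2\right)_k}\sum_{\nu_1+2\nu_2+3\nu_3+\dots=k}\frac{(-1)^{\nu_1+\nu_2+\dots}\left(\frac{\beta}2\right)_{\nu_1+\nu_2+\dots}}{\nu_1!\,\nu_2!\,\nu_3!\cdots}\,\sigma_1^{\nu_1}(\theta)\,\sigma_2^{\nu_2}(\theta)\cdots,$$ where the inner sum is over sequences of non-negative integers $\nu_1,\nu_2,\dots$ with $\sum_j j\nu_j=k$.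
   Context: For $\beta=1,2,4$, $\mathbb{H}_{n,\beta}$ is the real vector space of $n\times n$ real symmetric, complex Hermitian, respectively quaternionic Hermitian matrices, with inner product $\langle x|y\rangle=\Re\,\mathrm{tr}(xy)$. The law of $\mathbf P_1$ is rotation invariant if $U\mathbf P_1U^*\sim\mathbf P_1$ for all $U$ in $O(n)$, $U(n)$, $Sp(n)$ (quaternionic unitary matrices) respectively. $\sigma_j(\theta)$ is the $j$-th elementary symmetric function of the eigenvalues of $\theta$, with $\sigma_j=0$ for $j>n$. $(x)_k=x(x+1)\cdots(x+k-1)$ is the Pochhammer symbol, $(x)_0=1$. *)

(* Defs.v *)
From HB Require Import structures.
From mathcomp Require Import all_boot all_order all_algebra.
From mathcomp Require Import all_classical all_reals all_analysis.
From mathcomp Require Import ring.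

Set Implicit Arguments.
Unset Strict Implicit.
Unset Printing Implicit Defensive.

Import Order.TTheory GRing.Theory Num.Theory.
Import numFieldNormedType.Exports.

Local Open Scope classical_set_scope.
Local Open Scope ring_scope.

(* Quat a b c d is a + b i + c j + d k. *)
Record quat (R : Type) := Quat { qre : R; qi : R; qj : R; qk : R }.

Section QuatRing.
Variable R : realType.
Implicit Types x y z : quat R.

Definition quat_to_prod x : R * R * R * R := (qre x, qi x, qj x, qk x).
Definition quat_of_prod (p : R * R * R * R) : quat R :=
  let: (a, b, c, d) := p in Quat a b c d.

Lemma quat_to_prodK : cancel quat_to_prod quat_of_prod.
Proof. by case. Qed.

HB.instance Definition _ := Choice.copy (quat R) (can_type quat_to_prodK).

Definition qadd x y : quat R :=
  Quat (qre x + qre y) (qi x + qi y) (qj x + qj y) (qk x + qk y).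
Definition qopp x : quat R := Quat (- qre x) (- qi x) (- qj x) (- qk x).
Definition qmul x y : quat R :=
  Quat (qre x * qre y - qi x * qi y - qj x * qj y - qk x * qk y)
       (qre x * qi y + qi x * qre y + qj x * qk y - qk x * qj y)
       (qre x * qj y - qi x * qk y + qj x * qre y + qk x * qi y)
       (qre x * qk y + qi x * qj y - qj x * qi y + qk x * qre y).
Definition qreal (r : R) : quat R := Quat r 0 0 0.
Definition qconj x : quat R := Quat (qre x) (- qi x) (- qj x) (- qk x).

Fact qaddA : associative qadd.
Proof. by move=> [????] [????] [????]; rewrite /qadd /= !addrA. Qed.
Fact qaddC : commutative qadd.
Proof. by move=> [a b c d] [e f g h]; rewrite /qadd /=; congr Quat; ring. Qed.
Fact qadd0 : left_id (qreal 0) qadd.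
Proof. by move=> [????]; rewrite /qadd /= !add0r. Qed.
Fact qaddN : left_inverse (qreal 0) qopp qadd.
Proof. by move=> [????]; rewrite /qadd /= !addNr. Qed.

HB.instance Definition _ :=
  GRing.isZmodule.Build (quat R) qaddA qaddC qadd0 qaddN.

Fact qmulA : associative qmul.
Proof.
by move=> [a b c d] [e f g h] [p q r s]; rewrite /qmul /=; congr Quat; ring.
Qed.
Fact qmul1 : left_id (qreal 1) qmul.
Proof. by move=> [a b c d]; rewrite /qmul /=; congr Quat; ring. Qed.
Fact qmulr1 : right_id (qreal 1) qmul.
Proof. by move=> [a b c d]; rewrite /qmul /=; congr Quat; ring. Qed.
Fact qmulDl : left_distributive qmul qadd.
Proof.
by move=> [a b c d] [e f g h] [p q r s]; rewrite /qmul /qadd /=;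
  congr Quat; ring.
Qed.
Fact qmulDr : right_distributive qmul qadd.
Proof.
by move=> [a b c d] [e f g h] [p q r s]; rewrite /qmul /qadd /=;
  congr Quat; ring.
Qed.
Fact qone_neq0 : qreal 1 != 0 :> quat R.
Proof. by apply/eqP => -[/eqP]; rewrite oner_eq0. Qed.

HB.instance Definition _ := GRing.Zmodule_isNzRing.Build (quat R)
  qmulA qmul1 qmulr1 qmulDl qmulDr qone_neq0.

HB.instance Definition _ := isPointed.Build (quat R) 0.

End QuatRing.

(* The three cases live in one algebra: the real (beta = 1) and complex
   (beta = 2) numbers are the quaternions whose i, j, k components, resp. j, k
   components, vanish; beta = 4 imposes nothing. *)
Definition in_scalars (R : realType) (beta : nat) (q : quat R) : Prop :=
  [/\ (beta < 2)%N -> qi q = 0, (beta < 4)%N -> qj q = 0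
    & (beta < 4)%N -> qk q = 0].

Section HermitianMatrices.
Variables (R : realType) (n : nat).
Implicit Types x y U : 'M[quat R]_n.

Definition adjmx x : 'M[quat R]_n := (map_mx (@qconj R) x)^T.

Definition in_H (beta : nat) x : Prop :=
  (forall i j, in_scalars beta (x i j)) /\ adjmx x = x.

(* The group O(n), U(n) or Sp(n) for beta = 1, 2, 4. *)
Definition unitary (beta : nat) U : Prop :=
  [/\ forall i j, in_scalars beta (U i j),
      U *m adjmx U = 1%:M & adjmx U *m U = 1%:M].

Definition inner x y : R := qre (\tr (x *m y)).

Definition trace_one_projection (beta : nat) x : Prop :=
  [/\ in_H beta x, x *m x = x & \tr x = 1].

(* The columns of U form an orthonormal basis of eigenvectors of x. *)
Definition is_spectrum (beta : nat) x (l : 'rV[R]_n) : Prop :=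
  exists U, unitary beta U /\
    x *m U = U *m diag_mx (map_mx (@qreal R) l).

(* The eigenvalues with multiplicity, in an unspecified order; meaningful for
   hermitian x, by the spectral theorem. *)
Definition eigenvalues (beta : nat) x : 'rV[R]_n :=
  xget 0 [set l | is_spectrum beta x l].

(* Equal to 0 for j > n, the sum being then empty. *)
Definition sigma (beta : nat) (j : nat) x : R :=
  \sum_(A : {set 'I_n} | #|A| == j) \prod_(i in A) eigenvalues beta x 0 i.

(* Preimages of the Borel sets of R under the 4 n^2 real coordinates; they
   generate the Borel sigma-algebra of the matrix space. *)
Definition mx_cylinders : set (set 'M[quat R]_n) :=
  [set A | exists (i j : 'I_n) (c : quat R -> R) (B : set R),
     [/\ [\/ c = @qre R, c = @qi R, c = @qj R | c = @qk R], measurable B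
       & A = (fun x : 'M[quat R]_n => c (x i j)) @^-1` B] ].

Definition borel_mx := g_sigma_algebraType mx_cylinders.
End HermitianMatrices.

Definition rotation_invariant (R : realType) (n beta : nat)
    (mu : set (borel_mx R n) -> \bar R) : Prop :=
  forall U : 'M[quat R]_n, unitary beta U ->
  forall A : set (borel_mx R n), measurable A ->
    mu ((fun x : 'M[quat R]_n => U *m x *m adjmx U) @^-1` A) = mu A.

Definition pochhammer (R : realType) (x : R) (k : nat) : R :=
  \prod_(i < k) (x + i%:R).

(* The value nu i, for i : 'I_k, is nu_(i+1). Since j nu_j <= k whenever
   sum_j j nu_j = k, every solution has nu_j <= k for all j and nu_j = 0 for
   j > k, so no sequence is lost. *)
Definition inner_sum (R : realType) (n beta k : nat)
    (theta : 'M[quat R]_n) : R :=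
  \sum_(nu : {ffun 'I_k -> 'I_k.+1} | (\sum_(i < k) i.+1 * nu i == k)%N)
    let m := (\sum_(i < k) nu i)%N in
    (-1) ^+ m * pochhammer (beta%:R / 2) m / \prod_(i < k) ((nu i)`!)%:R
    * \prod_(i < k) sigma beta i.+1 theta ^+ nu i.

Definition expansion_term (R : realType) (n beta : nat)
    (theta : 'M[quat R]_n) (k : nat) : R :=
  (-1) ^+ k / pochhammer ((n * beta)%:R / 2) k * inner_sum beta k theta.

(* Main.v *)
(* Let theta = U D U^* with D = diag(l) (the spectral theorem holds over the three
   scalar algebras by maximising a linear functional of U^* theta U over the compact
   unitary group). By invariance, <theta|P_1> has the law of X = sum_i l_i p_i,
   where p_i are the diagonal entries of P_1.  Since P_1 has rank one,
   |P_1(i,j)|^2 = p_i p_j, so differentiating the invariance under plane rotations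
   gives, with b = beta / 2,
     b E[(p_i - p_j) X^k] = k (l_i - l_j) E[p_i p_j X^(k-1)].
   Summing over j and using sum_j p_j = 1,
     (n b + k) E[p_i X^k] = b E[X^k] + k l_i E[p_i X^(k-1)],
   so x_k = E[X^k] (n b)_k / k! satisfies a linear recursion whose generating
   function is prod_i (1 - l_i t)^(-b).  Expanding this as (1 - s)^(-b), where
   1 - s = sum_j (-t)^j sigma_j, gives the inner sums. *)
Require Import Defs.
From HB Require Import structures.
From mathcomp Require Import all_boot all_order all_algebra.
From mathcomp Require Import all_classical all_reals all_analysis.
From mathcomp Require Import measurable_realfun ring lra zify.

Set Implicit Arguments.
Unset Strict Implicit.
Unset Printing Implicit Defensive.

Import Order.TTheory GRing.Theory Num.Theory.
Import numFieldNormedType.Exports.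

Local Open Scope classical_set_scope.
Local Open Scope ring_scope.

(** Since $b$ may be $1/2$, $(1-s)^{-b}$ need not be a rational function; it enters only through a
    truncation of its Newton series. That truncation and the generating function of the $x_k$ both
    solve $e\,p' = -b\,e'\,p$ modulo $t^N$, with $e=\prod_i(1-l_it)$. As $e(0)=1$, this equation and
    $p(0)$ determine $p$, so no logarithm or real power of a series has to be formed. Quaternions do
    not commute, which rules out the characteristic polynomial and leaves only the real part of the
    trace cyclic. Hence eigenvalues come from compactness, and rank one is expressed by norms of
    entries. The step from moments to $L_n$ is dominated convergence: the entries of a trace-one
    projection have norm at most 1, so $X$ is bounded and the partial sums of the exponential share
    a constant bound. *)

Section PowerSeries.
Variable R : realType.
Implicit Types (p q e s : {poly R}) (a : nat -> R) (b : R) (N : nat).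

(** * Formal power series, represented by polynomials modulo ['X^N] *)

Definition eq_modX N p q := forall i, (i < N)%N -> p`_i = q`_i.

Lemma eq_modX_trans N p q r : eq_modX N p q -> eq_modX N q r -> eq_modX N p r.
Proof. by move=> pq qr i iN; rewrite pq // qr. Qed.

Lemma eq_modXM N p p' q q' :
  eq_modX N p p' -> eq_modX N q q' -> eq_modX N (p * q) (p' * q').
Proof.
move=> pp' qq' i iN; rewrite !coefM; apply: eq_bigr => j _.
by rewrite pp' ?qq' //; [lia | move: (ltn_ord j); lia].
Qed.

Lemma eq_modX_exp N p q m : eq_modX N p q -> eq_modX N (p ^+ m) (q ^+ m).
Proof.
move=> pq; elim: m => [|m IH]; first by rewrite !expr0.
by rewrite !exprS; exact: eq_modXM.
Qed.

Lemma eq_modX_sum N (I : Type) (r : seq I) (P : pred I) (F G : I -> {poly R}) :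
  (forall i, P i -> eq_modX N (F i) (G i)) ->
  eq_modX N (\sum_(i <- r | P i) F i) (\sum_(i <- r | P i) G i).
Proof.
by move=> FG j jN; rewrite !coef_sum; apply: eq_bigr => i /FG; exact.
Qed.

Lemma deriv_prod (I : finType) (F : I -> {poly R}) :
  (\prod_i F i)^`() = \sum_i (F i)^`() * \prod_(j | j != i) F j.
Proof.
(* On a duplicate-free list, omitting the index [i] drops exactly one factor, so induction on the
   list applies. *)
suff H (r : seq I) : uniq r -> (\prod_(i <- r) F i)^`() =
    \sum_(i <- r) (F i)^`() * \prod_(j <- r | j != i) F j.
  by rewrite H ?index_enum_uniq.
elim: r => [|i r IH] /=; first by rewrite !big_nil derivC.
move=> /andP[ir ur]; rewrite !big_cons derivM IH // eqxx /=; congr (_ + _).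
  by congr (_ * _); rewrite [RHS]big_seq_cond [LHS]big_seq;
    apply: eq_bigl => j; case: eqVneq ir => [-> /negPf ->|]; rewrite ?andbT.
rewrite mulr_sumr !big_seq; apply: eq_bigr => j jr; rewrite big_cons.
by rewrite ifT 1?mulrCA //; apply: contraNneq ir => ->.
Qed.

Definition inv_fact m : R := (m`!)%:R^-1.

Lemma inv_factS m : m.+1%:R * inv_fact m.+1 = inv_fact m.
Proof.
by rewrite /inv_fact factS natrM invfM mulrA divff ?mul1r ?pnatr_eq0.
Qed.

Lemma inv_fact_bin m j : (j <= m)%N ->
  inv_fact j * inv_fact (m - j) = inv_fact m * ('C(m, j))%:R.
Proof.
move=> jm; rewrite /inv_fact -(bin_fact jm) !natrM.
have h i : (i`!)%:R != 0 :> R by rewrite pnatr_eq0 -lt0n fact_gt0.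
have hC : ('C(m, j))%:R != 0 :> R by rewrite pnatr_eq0 -lt0n bin_gt0.
by field; rewrite !h hC.
Qed.

(* Read off the coefficient of T^m in the product of the truncated
   exponentials of z_i T. *)
Lemma multinomial_expansion k K (z : 'I_k -> {poly R}) m : (m <= K)%N ->
  inv_fact m *: (\sum_i z i) ^+ m =
  \sum_(nu : {ffun 'I_k -> 'I_K.+1} | (\sum_i nu i == m)%N)
    \prod_i (inv_fact (nu i) *: z i ^+ nu i).
Proof.
move=> mK; pose E (x : {poly R}) := \poly_(r < K.+1) (inv_fact r *: x ^+ r).
have coefE (r : seq 'I_k) j : (j <= K)%N ->
    (\prod_(i <- r) E (z i))`_j = inv_fact j *: (\sum_(i <- r) z i) ^+ j.
  elim: r j => [|i r IH] j jK.
    rewrite !big_nil coef1; case: j jK => [|j] _.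
      by rewrite expr0 /inv_fact invr1 scale1r.
    by rewrite expr0n scaler0.
  rewrite !big_cons coefM exprDn scaler_sumr.
  rewrite (reindex_inj rev_ord_inj) /=; apply: eq_bigr => u _.
  have uj : (u <= j)%N by rewrite -ltnS.
  rewrite subSS IH; last lia.
  rewrite coef_poly ifT; last lia.
  rewrite -scalerAl -scalerAr scalerA subKn // mulrC inv_fact_bin //.
  by rewrite -scalerA scaler_nat.
rewrite -coefE //.
have -> : \prod_i E (z i) = \sum_(nu : {ffun 'I_k -> 'I_K.+1})
   (\prod_i (inv_fact (nu i) *: z i ^+ nu i)) *: 'X^(\sum_i nu i).
  under eq_bigr do rewrite /E poly_def.
  rewrite bigA_distr_bigA; apply: eq_bigr => nu _.
  rewrite expr_sum -mul_polyC rmorph_prod -big_split /=.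
  by apply: eq_bigr => i _; rewrite mul_polyC.
rewrite coef_sum [RHS]big_mkcond; apply: eq_bigr => nu _.
by rewrite coefZ coefXn eq_sym; case: eqP => _; rewrite ?mulr1 ?mulr0.
Qed.

(** A truncated series without constant term (not a Newton power sum). The shift puts [a i] in
    degree [i.+1], matching the indexing of [inner_sum], where [nu i] stands for $\nu_{i+1}$. *)
Definition power_sum_poly N a : {poly R} := \sum_(i < N) a i *: 'X^(i.+1).

Lemma coef_power_sum_poly N a k :
  (power_sum_poly N a)`_k = if (0 < k <= N)%N then a k.-1 else 0.
Proof.
rewrite coef_sum; case: ifPn => [/andP[k0 kN]|hk].
  have kN' : (k.-1 < N)%N by lia.
  rewrite (bigD1 (Ordinal kN')) //= big1 ?addr0 => [|i ik].
    by rewrite coefZ coefXn prednK // eqxx mulr1.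
  rewrite coefZ coefXn; case: eqP => [ki|_]; rewrite ?mulr0 //.
  by case/eqP: ik; apply/val_inj; rewrite /= ki.
rewrite big1 // => i _; rewrite coefZ coefXn; case: eqP => [ki|_];
  rewrite ?mulr0 //.
by move: hk; rewrite ki /= ltn_ord.
Qed.

Lemma coef_power_sum_exp N a m k : (k < m)%N ->
  (power_sum_poly N a ^+ m)`_k = 0.
Proof.
move=> km; have -> : power_sum_poly N a = 'X * \sum_(i < N) (a i *: 'X^i : {poly R}).
  by rewrite mulr_sumr; apply: eq_bigr => i _; rewrite -scalerAr -exprS.
by rewrite exprMn coefXnM km.
Qed.

(** The coefficient of $t^k$ in $(1-\sum_i a_i t^{i+1})^{-b}$; it has the shape of [inner_sum], with
    all signs absorbed into [a]. *)
Definition partition_sum b a k : R :=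
  \sum_(nu : {ffun 'I_k -> 'I_k.+1} | (\sum_(i < k) i.+1 * nu i == k)%N)
    pochhammer b (\sum_(i < k) nu i)%N *
    \prod_(i < k) (inv_fact (nu i) * a i ^+ nu i).

(** Newton's series of $(1-s)^{-b}$, cut by the power of [s] rather than by degree: when [s] has no
    constant term, the dropped powers do not reach degree [N]. *)
Definition binomial_series b N s : {poly R} :=
  \sum_(m < N.+1) (pochhammer b m * inv_fact m) *: s ^+ m.

Lemma coef_binomial_series b a N k : (k <= N)%N ->
  (binomial_series b N (power_sum_poly N a))`_k = partition_sum b a k.
Proof.
move=> kN; rewrite coef_sum.
(* In degree [k] only the powers [m <= k] and the first [k] values of [a] contribute, so [N] can be
   lowered to [k], the range used by [partition_sum]. *)
transitivity (\sum_(m < k.+1)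
   (pochhammer b m * inv_fact m) * (power_sum_poly k a ^+ m)`_k).
  rewrite (big_ord_widen_cond N.+1 xpredT
     (fun m => pochhammer b m * inv_fact m * (power_sum_poly k a ^+ m)`_k)) //.
  rewrite [RHS]big_mkcond; apply: eq_bigr => m _; rewrite coefZ ltnS.
  case: leqP => mk; last by rewrite coef_power_sum_exp // mulr0.
  congr (_ * _); apply: (@eq_modX_exp k.+1) => // i ik.
  rewrite !coef_power_sum_poly; congr (if _ then _ else _); lia.
under eq_bigr => m _.
  rewrite -mulrA -coefZ (@multinomial_expansion _ k) -1?ltnS //.
  rewrite coef_sum mulr_sumr; under eq_bigr => nu hnu.
    rewrite -(eqP hnu).
    have -> : \prod_(i < k) (inv_fact (nu i) *: (a i *: 'X^(i.+1)) ^+ nu i) =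
      (\prod_(i < k) (inv_fact (nu i) * a i ^+ nu i)) *:
        'X^(\sum_(i < k) i.+1 * nu i).
      rewrite expr_sum -mul_polyC rmorph_prod -big_split /=.
      apply: eq_bigr => i _.
      by rewrite exprZn scalerA -exprM mul_polyC.
    rewrite coefZ coefXn.
  over.
over.
rewrite /partition_sum (exchange_big_dep xpredT) //= [RHS]big_mkcond /=.
apply: eq_bigr => nu _; case: ifPn => [/eqP hk|hk]; last first.
  by rewrite big1 // => m _; rewrite eq_sym (negPf hk) !mulr0.
(* The weights [i.+1] are at least 1, so the total of [nu] is at most [k], and exactly one [m] of
   the inner sum matches it. *)
have hm : (\sum_i nu i < k.+1)%N.
  by rewrite ltnS -[leqRHS]hk; apply: leq_sum => i _; rewrite leq_pmull.
rewrite (big_pred1 (Ordinal hm)) /= ?hk ?eqxx ?mulr1 //.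
Qed.

(** Truncating breaks the equation of $(1-s)^{-b}$ by a single multiple of $s's^N$, and ['X^N]
    divides $s^N$ because [s] has no constant term. *)
Lemma binomial_series_ode b N s : s`_0 = 0 ->
  eq_modX N ((1 - s) * (binomial_series b N s)^`())
            (b *: (s^`() * binomial_series b N s)).
Proof.
move=> s0 i iN.
have sX : s = 'X * (drop_poly 1 s).
  rewrite -{1}(poly_take_drop 1 s) expr1 mulrC.
  suff -> : take_poly 1 s = 0 by rewrite add0r.
  by apply/polyP => -[|j]; rewrite coef_take_poly coef0.
pose c m := pochhammer b m * inv_fact m.
have cS m : m.+1%:R * c m.+1 = (b + m%:R) * c m.
  rewrite /c {1}/pochhammer big_ord_recr /= mulrCA -mulrA inv_factS.
  by rewrite mulrCA mulrA mulrC mulrA.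
(* An exact identity with its error term, proved by induction on [N]; the recurrence [cS] makes the
   successive errors telescope. *)
have -> : (1 - s) * (binomial_series b N s)^`() =
   b *: (s^`() * binomial_series b N s)
   - (c N * (b + N%:R)) *: (s^`() * s ^+ N).
  rewrite /binomial_series; elim: {i iN} N => [|N IH].
    rewrite !big_ord_recl !big_ord0 expr0 !addr0 -/(c _) derivZ derivC.
    by rewrite scaler0 mulr0 mulr1 -scalerAr mulr1 scalerA mulrC subrr.
  rewrite !(big_ord_recr N.+1) /= -/(c _) derivD mulrDr IH derivZ deriv_exp /=.
  move: (c N.+1) (c N) (cS N) => c1 c0 /(congr1 polyC).
  rewrite -!mul_polyC !polyCM !polyCD !polyC_natr exprS => cSN.
  set S := \sum_(_ < _) _.
  transitivity (b%:P * (s^`() * S) + (1 - s) * (s^`() * s ^+ N) *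
      (N.+1%:R * c1%:P) - (b%:P + N%:R) * c0%:P * (s^`() * s ^+ N)).
     by ring.
  rewrite -cSN;  ring.
rewrite coefB -[RHS]subr0; congr (_ - _); rewrite coefZ.
by rewrite sX exprMn mulrCA coefXnM iN mulr0.
Qed.

(** Because $e_0=1$, the coefficient of degree $k$ expresses $(k+1)p_{k+1}$ through $p_0,\dots,p_k$.
    Equations in degrees below [N] thus reach the coefficient of degree [N], whence [N.+1] in the
    conclusion. *)
Lemma ode_unique b N e p q : e`_0 = 1 -> p`_0 = q`_0 ->
  eq_modX N (e * p^`()) (- b *: (e^`() * p)) ->
  eq_modX N (e * q^`()) (- b *: (e^`() * q)) -> eq_modX N.+1 p q.
Proof.
move=> e0 pq0 hp hq k; elim/ltn_ind: k => -[//|k] IH kN.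
have /eqP : (e * (p - q)^`())`_k = (- b *: (e^`() * (p - q)))`_k.
  by rewrite derivB !mulrBr scalerBr !coefB hp ?hq.
rewrite coefM big_ord_recl /= e0 mul1r subn0 coefZ coefM.
rewrite !big1 ?addr0 ?mulr0.
- rewrite coef_deriv mulrn_eq0 /= coefB subr_eq0 => /eqP ->//.
- by move=> i _; rewrite coefB IH ?subrr ?mulr0 //; lia.
- move=> i _; rewrite coef_deriv coefB IH ?subrr ?mul0rn ?mulr0 //.
    by rewrite /bump; move: (ltn_ord i); lia.
  by rewrite /bump; move: (ltn_ord i); lia.
Qed.

(** * Solving the moment recursion by its generating function *)

Section Recursion.
Variables (n : nat) (l : 'I_n -> R) (b : R) (x : nat -> R).
Variable y : 'I_n -> nat -> R.
Hypothesis x0 : x 0%N = 1.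
Hypothesis y0 : forall i, y i 0%N = b * x 0%N.
Hypothesis yS : forall i k, y i k.+1 = b * x k.+1 + l i * y i k.
Hypothesis xS : forall k, k.+1%:R * x k.+1 = \sum_i l i * y i k.

Definition elem_sym j : R := \sum_(A : {set 'I_n} | #|A| == j) \prod_(i in A) l i.

Definition rev_charpoly : {poly R} := \prod_i (1 - (l i)%:P * 'X).

Lemma rev_charpolyE N : (n <= N)%N -> rev_charpoly =
  1 - power_sum_poly N (fun j => (-1) ^+ j * elem_sym j.+1).
Proof.
move=> nN; apply/polyP => k.
have -> : rev_charpoly = \sum_(A : {set 'I_n})
    ((-1) ^+ #|A| * \prod_(i in A) l i) *: 'X^#|A|.
  rewrite /rev_charpoly; under eq_bigr do rewrite addrC.
  rewrite bigA_distr; apply: eq_bigr => A _.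
  rewrite -big_mkcond /= -mul_polyC polyCM rmorph_prod rmorphXn rmorphN1.
  rewrite -!prodr_const -!big_split /=.
  by apply: eq_bigr => i _; rewrite mulN1r mulNr.
rewrite coef_sum coefB coef1 coef_power_sum_poly.
under eq_bigr do rewrite coefZ coefXn.
have -> : \sum_(A : {set 'I_n}) (-1) ^+ #|A| * \prod_(i in A) l i * (k == #|A|)%:R
   = (-1) ^+ k * elem_sym k.
  rewrite mulr_sumr [RHS]big_mkcond; apply: eq_bigr => A _.
  by rewrite eq_sym; case: eqP => [->|_]; rewrite ?mulr1 ?mulr0.
case: k => [|k] /=.
  rewrite subr0 expr0 mul1r /elem_sym (big_pred1 finset.set0) ?big_set0 // => A.
  by rewrite cards_eq0.
rewrite sub0r; case: ifPn => kN; first by rewrite exprS mulN1r mulNr.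
rewrite /elem_sym big1 ?mulr0 ?oppr0 // => A /eqP Ak.
by move: (max_card (mem A)); rewrite card_ord Ak; lia.
Qed.

(** In generating functions the hypotheses read $(1-l_it)y_i=bx$ and $x'=\sum_i l_iy_i$. So
    $x'/x=\sum_i bl_i/(1-l_it)$, the logarithmic derivative of $\prod_i(1-l_it)^{-b}$. *)
Lemma recursion_solution k :
  x k = partition_sum b (fun j => (-1) ^+ j * elem_sym j.+1) k.
Proof.
(* Large enough for two purposes: [n <= N] makes [rev_charpolyE] exact, and [k <= N] keeps the
   wanted coefficient. *)
pose N := (n + k)%N.
pose a j := (-1) ^+ j * elem_sym j.+1.
pose px := \poly_(i < N.+1) x i.
pose py i := \poly_(j < N) y i j.
have eE := @rev_charpolyE N (leq_addr _ _).
have ps0 : (power_sum_poly N a)`_0 = 0 by rewrite coef_power_sum_poly.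
have kN : (k < N.+1)%N by rewrite ltnS leq_addl.
have -> : x k = px`_k by rewrite coef_poly kN.
have kN' : (k <= N)%N by exact: leq_addl.
rewrite -(coef_binomial_series b _ kN').
apply: (@ode_unique b N rev_charpoly) => //.
- by rewrite eE coefB ps0 coef1 subr0.
- rewrite coef_poly /= x0 coef_binomial_series // /partition_sum.
  rewrite (big_pred1 (finfun (fun=> ord0))).
    by rewrite !big_ord0 mulr1 /pochhammer big_ord0.
  move=> nu; rewrite big_ord0 eqxx; symmetry; apply/eqP/ffunP => -[].
  by [].
- have pyE i : eq_modX N ((1 - (l i)%:P * 'X) * py i) (b *: px).
    move=> j jN; rewrite mulrBl mul1r coefB -mulrA coefCM coefXM coefZ.
    rewrite !coef_poly jN (leqW jN : (j < N.+1)%N).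
    case: j jN => [|j] jN /=; first by rewrite mulr0 subr0 y0 x0.
    by rewrite (ltnW jN) yS addrK.
  have pxE : eq_modX N px^`() (\sum_i (l i)%:P * py i).
    move=> j jN; rewrite coef_deriv coef_poly ltnS jN coef_sum.
    rewrite -mulr_natl xS; apply: eq_bigr => i _.
    by rewrite coefCM coef_poly jN.
  apply: eq_modX_trans (eq_modXM (fun _ _ => erefl) pxE) _.
  rewrite deriv_prod mulr_suml mulr_sumr scaler_sumr.
  apply: eq_modX_sum => i _.
  have -> : rev_charpoly * ((l i)%:P * py i) =
     ((l i)%:P * \prod_(j | j != i) (1 - (l j)%:P * 'X)) *
     ((1 - (l i)%:P * 'X) * py i).
    rewrite {1}/rev_charpoly (bigD1 i) //=; ring.
  have -> : - b *: ((1 - (l i)%:P * 'X)^`() *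
      \prod_(j | j != i) (1 - (l j)%:P * 'X) * px) =
     ((l i)%:P * \prod_(j | j != i) (1 - (l j)%:P * 'X)) * (b *: px).
    rewrite derivB derivC deriv_mulC derivX -!mul_polyC polyCN; ring.
  exact: eq_modXM.
- rewrite {1}eE; apply: eq_modX_trans (@binomial_series_ode b N _ ps0) _.
  rewrite eE derivB derivC sub0r mulNr scalerN scaleNr opprK //.
Qed.
End Recursion.
End PowerSeries.

(** * Quaternion norm, coordinates and the three scalar algebras *)

Section Quaternions.
Variable R : realType.
Implicit Types (x y z e : quat R) (r s c : R).

Definition qnorm2 x : R := qre x ^+ 2 + qi x ^+ 2 + qj x ^+ 2 + qk x ^+ 2.

Lemma quatP x y : qre x = qre y -> qi x = qi y -> qj x = qj y -> qk x = qk y ->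
  x = y.
Proof. by case: x => ????; case: y => ???? /= -> -> -> ->. Qed.

Lemma qreal0 : qreal 0 = 0 :> quat R. Proof. by []. Qed.
Lemma qconjK : involutive (@qconj R).
Proof. by case=> ????; rewrite /qconj /= !opprK. Qed.
Lemma qconj_real r : qconj (qreal r) = qreal r.
Proof. by rewrite /qconj /= !oppr0. Qed.
Lemma qconj0 : qconj (0 : quat R) = 0.
Proof. exact: qconj_real. Qed.
Lemma qconj1 : qconj (1 : quat R) = 1.
Proof. exact: qconj_real. Qed.
Lemma qconjD : {morph @qconj R : x y / x + y}.
Proof. by move=> x y; apply: quatP => /=; rewrite ?opprD. Qed.
Lemma qconjM x y : qconj (x * y) = qconj y * qconj x.
Proof. by apply: quatP => /=; ring. Qed.

Lemma qre_mulC x y : qre (x * y) = qre (y * x).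
Proof. by rewrite /=; ring. Qed.
Lemma mul_qconj x : x * qconj x = qreal (qnorm2 x).
Proof. by apply: quatP; rewrite /qnorm2 /=; ring. Qed.
Lemma qnorm2_ge0 x : 0 <= qnorm2 x.
Proof. by rewrite /qnorm2 !addr_ge0 ?sqr_ge0. Qed.
Lemma qnorm2_eq0 x : qnorm2 x = 0 -> x = 0.
Proof.
rewrite /qnorm2 => h.
by apply: quatP => /=; apply/eqP; rewrite -sqrf_eq0; apply/eqP; nra.
Qed.
Lemma qnorm2_conj x : qnorm2 (qconj x) = qnorm2 x.
Proof. by rewrite /qnorm2 /=; ring. Qed.
Lemma qnorm2M x y : qnorm2 (x * y) = qnorm2 x * qnorm2 y.
Proof. by rewrite /qnorm2 /=; ring. Qed.

Definition qcomponent (c : quat R -> R) : Prop :=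
  [\/ c = @qre R, c = @qi R, c = @qj R | c = @qk R].

Lemma qcomponent_le (c : quat R -> R) x : qcomponent c -> c x ^+ 2 <= qnorm2 x.
Proof. by rewrite /qnorm2; case=> ->; nra. Qed.

Section Sums.
Variables (I : Type) (s : seq I) (P : pred I) (F : I -> quat R).
Lemma qcomponent_sum (c : quat R -> R) : qcomponent c ->
  c (\sum_(i <- s | P i) F i) = \sum_(i <- s | P i) c (F i).
Proof. by case=> ->; apply: (big_morph _ (id1 := 0) (op1 := +%R)). Qed.
Lemma qre_sum : qre (\sum_(i <- s | P i) F i) = \sum_(i <- s | P i) qre (F i).
Proof. by apply: qcomponent_sum; constructor. Qed.
Lemma qconj_sum :
  qconj (\sum_(i <- s | P i) F i) = \sum_(i <- s | P i) qconj (F i).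
Proof. exact: (big_morph _ qconjD qconj0). Qed.
Lemma qreal_sum (G : I -> R) :
  qreal (\sum_(i <- s | P i) G i) = \sum_(i <- s | P i) qreal (G i).
Proof.
apply: (big_morph _ _ qreal0) => a b.
by apply: quatP => /=; rewrite ?addr0.
Qed.
End Sums.

Section Scalars.
Variable beta : nat.
Lemma in_scalars_real r : in_scalars beta (qreal r).
Proof. by split. Qed.
Lemma in_scalarsD x y :
  in_scalars beta x -> in_scalars beta y -> in_scalars beta (x + y).
Proof.
move=> [x1 x2 x3] [y1 y2 y3].
by split=> h /=; [rewrite x1 ?y1|rewrite x2 ?y2|rewrite x3 ?y3]; rewrite ?addr0.
Qed.
Lemma in_scalars_conj x : in_scalars beta x -> in_scalars beta (qconj x).
Proof. by move=> [x1 x2 x3]; split=> /= h; rewrite ?x1 ?x2 ?x3 ?oppr0. Qed.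
Lemma in_scalarsN x : in_scalars beta x -> in_scalars beta (- x).
Proof. by move=> [x1 x2 x3]; split=> /= h; rewrite ?x1 ?x2 ?x3 ?oppr0. Qed.
Lemma in_scalarsM x y :
  in_scalars beta x -> in_scalars beta y -> in_scalars beta (x * y).
Proof.
move=> [x1 x2 x3] [y1 y2 y3]; split=> h /=; last 2 first.
- by rewrite x2 ?x3 ?y2 ?y3 //; ring.
- by rewrite x2 ?x3 ?y2 ?y3 //; ring.
have h4 : (beta < 4)%N by apply: leq_trans h _.
by rewrite x1 ?x2 ?x3 ?y1 ?y2 ?y3 //; ring.
Qed.
Lemma in_scalars_sum (I : finType) (F : I -> quat R) :
  (forall i, in_scalars beta (F i)) -> in_scalars beta (\sum_i F i).
Proof.
by move=> h; apply: (big_ind (in_scalars beta)) => //; exact: in_scalarsD.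
Qed.
End Scalars.

(* The real units of the scalar algebra: 1, i, j, k truncated to dimension
   beta. *)
Definition qunits (beta : nat) : seq (quat R) :=
  take beta [:: Quat 1 0 0 0; Quat 0 1 0 0; Quat 0 0 1 0; Quat 0 0 0 1].

Lemma qunits_norm2 beta e : e \in qunits beta -> qnorm2 e = 1.
Proof.
by move=> /mem_take; rewrite !inE => /or4P[] /eqP ->;
  rewrite /qnorm2 /= !expr0n expr1n /= ?addr0 ?add0r.
Qed.

Lemma size_qunits beta : beta \in [:: 1; 2; 4]%N -> size (qunits beta) = beta.
Proof. by rewrite !inE => /or3P[] /eqP ->. Qed.

Lemma qunits_in_scalars beta e : beta \in [:: 1; 2; 4]%N ->
  e \in qunits beta -> in_scalars beta e.
Proof.
rewrite !inE => /or3P[] /eqP ->; rewrite !inE.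
- by move=> /eqP ->.
- by move=> /orP[] /eqP ->; split.
- by move=> /or4P[] /eqP ->; split.
Qed.

(** Pythagoras in the orthonormal basis [qunits beta]: [qre (x * qconj e)] is the coordinate of [x]
    along [e]. *)
Lemma qnorm2_units beta x : beta \in [:: 1; 2; 4]%N -> in_scalars beta x ->
  qnorm2 x = \sum_(e <- qunits beta) qre (x * qconj e) ^+ 2.
Proof.
rewrite /qnorm2 !inE => /or3P[] /eqP -> [h1 h2 h3]; rewrite !big_cons ?big_nil /=.
- by rewrite h1 // h2 // h3 //; ring.
- by rewrite h2 // h3 //; ring.
- ring.
Qed.

End Quaternions.

(** * Hermitian and unitary matrices over the scalar algebras *)

Section HermitianMatrixTheory.
Variables (R : realType) (n beta : nat).
Implicit Types (x y z U V W : 'M[quat R]_n).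

Lemma adjmxE x i j : adjmx x i j = qconj (x j i).
Proof. by rewrite !mxE. Qed.
Lemma adjmxK : involutive (@adjmx R n).
Proof. by move=> x; apply/matrixP => i j; rewrite !adjmxE qconjK. Qed.
Lemma adjmxM x y : adjmx (x *m y) = adjmx y *m adjmx x.
Proof.
apply/matrixP => i j; rewrite adjmxE !mxE qconj_sum.
by apply: eq_bigr => k _; rewrite qconjM !adjmxE.
Qed.

Lemma in_HP x i j : in_H beta x -> x j i = qconj (x i j).
Proof. by move=> [_ h]; rewrite -adjmxE h. Qed.

Lemma in_H_diag x i : in_H beta x -> x i i = qreal (qre (x i i)).
Proof.
move=> /(in_HP i i); case: (x i i) => a b c d [] /= hb hc hd.
by rewrite /qreal; congr Quat; lra.
Qed.

Lemma inner_mulC x y : inner x y = inner y x.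
Proof.
rewrite /inner /mxtrace !qre_sum; under eq_bigr do rewrite mxE qre_sum.
rewrite exchange_big; apply: eq_bigr => i _; rewrite mxE qre_sum.
by apply: eq_bigr => j _; rewrite qre_mulC.
Qed.

Lemma unitary_adj U : unitary beta U -> unitary beta (adjmx U).
Proof.
move=> [hs h1 h2]; split; rewrite ?adjmxK // => i j.
by rewrite adjmxE; apply: in_scalars_conj.
Qed.

Lemma unitary1 : unitary beta (1%:M : 'M[quat R]_n).
Proof.
have h : adjmx (1%:M : 'M[quat R]_n) = 1%:M.
  apply/matrixP => i j; rewrite adjmxE !mxE eq_sym.
  by case: eqP; rewrite ?qconj1 ?qconj0.
split; rewrite ?h ?mulmx1 // => i j; rewrite mxE.
by case: eqP => _; exact: in_scalars_real.
Qed.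

Lemma unitaryM U V : unitary beta U -> unitary beta V -> unitary beta (U *m V).
Proof.
move=> [us u1 u2] [vs v1 v2]; split.
- by move=> i j; rewrite mxE; apply: in_scalars_sum => k; exact: in_scalarsM.
- by rewrite adjmxM mulmxA -(mulmxA U) v1 mulmx1.
- by rewrite adjmxM mulmxA -(mulmxA _ (adjmx U)) u2 mulmx1.
Qed.

Lemma in_H_conj U x : unitary beta U -> in_H beta x ->
  in_H beta (U *m x *m adjmx U).
Proof.
move=> [us _ _] [xs xh]; split => [i j|].
  rewrite mxE; apply: in_scalars_sum => k; apply: in_scalarsM.
    by rewrite mxE; apply: in_scalars_sum => m; apply: in_scalarsM.
  by rewrite adjmxE; exact: in_scalars_conj.
by rewrite !adjmxM adjmxK xh mulmxA.
Qed.

Lemma unitary_row U i : unitary beta U -> \sum_j qnorm2 (U i j) = 1.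
Proof.
move=> [_ /matrixP /(_ i i) + _]; rewrite !mxE eqxx => /(congr1 (@qre R)).
rewrite qre_sum => h.
rewrite -[RHS]/(qre (true%:R : quat R)) -h; apply: eq_bigr => j _.
by rewrite adjmxE mul_qconj.
Qed.

(** * Rotations of a coordinate plane *)

Section Givens.
Variables (i j : 'I_n) (ij : i != j).

(** A plane rotation with phase [e]. Letting [e] run over the real units probes every real
    coordinate of the entry [x i j]. *)
Definition givens (c s : R) (e : quat R) : 'M[quat R]_n :=
  \matrix_(a, b)
    if a == i then
      if b == i then qreal c else if b == j then qreal s * e else 0
    else if a == j then
      if b == i then - (qreal s * qconj e) else if b == j then qreal c else 0
    else (a == b)%:R.

Lemma givens_mul c s e y a b : (givens c s e *m y) a b =
  if a == i then qreal c * y i b + qreal s * e * y j b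
  else if a == j then - (qreal s * qconj e) * y i b + qreal c * y j b
  else y a b.
Proof.
have ji : (j == i) = false by rewrite eq_sym (negPf ij).
rewrite mxE; case: (eqVneq a i) => [->|ai].
  rewrite (bigD1 i) //= (bigD1 j) ?ji //= big1 => [|k /andP[/negPf ki /negPf kj]].
    by rewrite !mxE !eqxx ji addr0.
  by rewrite !mxE eqxx ki kj mul0r.
case: (eqVneq a j) => [->|aj].
  rewrite (bigD1 i) //= (bigD1 j) ?ji //= big1 => [|k /andP[/negPf ki /negPf kj]].
    by rewrite !mxE ji !eqxx addr0.
  by rewrite !mxE ji eqxx ki kj mul0r.
rewrite (bigD1 a) //= big1 => [|k /negPf ka].
  by rewrite !mxE (negPf ai) (negPf aj) eqxx mul1r addr0.
by rewrite !mxE (negPf ai) (negPf aj) eq_sym ka mul0r.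
Qed.

Lemma adj_givens c s e : adjmx (givens c s e) = givens c (- s) e.
Proof.
have ji : (j == i) = false by rewrite eq_sym (negPf ij).
apply/matrixP => a b; rewrite adjmxE !mxE.
case: (eqVneq b i) => [bi|bi]; case: (eqVneq a i) => [ai|ai];
  rewrite ?bi ?ai ?eqxx ?(negPf ij) ?ji //.
- by rewrite qconj_real.
- case: (eqVneq a j) => [aj|aj]; last by rewrite (negPf ai) qconj0.
  by apply: quatP => /=; ring.
- case: (eqVneq b j) => [bj|bj]; last by rewrite (negPf bi) qconj0.
  by apply: quatP => /=; ring.
- case: (eqVneq b j) => [bj|bj]; case: (eqVneq a j) => [aj|aj];
    rewrite ?bj ?aj ?eqxx ?qconj_real ?qconj0 //.
  + by rewrite (negPf aj).
  + by rewrite (negPf bj) qconj0.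
  + by rewrite eq_sym; case: eqP; rewrite ?qconj1 ?qconj0.
Qed.

Lemma givens_unitary c s e : in_scalars beta e -> qnorm2 e = 1 ->
  c ^+ 2 + s ^+ 2 = 1 -> unitary beta (givens c s e).
Proof.
move=> he e1.
have ji : (j == i) = false by rewrite eq_sym (negPf ij).
have key t : c ^+ 2 + t ^+ 2 = 1 -> givens c t e *m givens c (- t) e = 1%:M.
  move=> ct; apply/matrixP => a b; rewrite givens_mul !mxE !eqxx ji.
  have E : qreal c * qreal c + qreal t * e * - (qreal (- t) * qconj e) = 1.
    (* The norm of [e] stays symbolic so that the identity is polynomial in real coordinates; it is
       set to 1 afterwards. The same device recurs in the conjugation formulas below. *)
    transitivity (qreal (c ^+ 2 + t ^+ 2 * qnorm2 e)).
      by rewrite /qnorm2; apply: quatP => /=; ring.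
    by rewrite e1 mulr1 ct.
  have E' : - (qreal t * qconj e) * (qreal (- t) * e) + qreal c * qreal c = 1.
    transitivity (qreal (c ^+ 2 + t ^+ 2 * qnorm2 e)).
      by rewrite /qnorm2; apply: quatP => /=; ring.
    by rewrite e1 mulr1 ct.
  case: (eqVneq a i) => [ai|ai].
    case: (eqVneq b i) => [bi|bi]; first by rewrite E ai bi eqxx.
    case: (eqVneq b j) => [bj|bj].
      by rewrite ai bj (negPf ij); apply: quatP => /=; ring.
    by rewrite !mulr0 addr0 ai eq_sym (negPf bi).
  case: (eqVneq a j) => [aj|aj] //.
  case: (eqVneq b i) => [bi|bi].
    by rewrite aj bi ji; apply: quatP => /=; ring.
  case: (eqVneq b j) => [bj|bj]; first by rewrite E' aj bj eqxx.
  by rewrite !mulr0 addr0 aj eq_sym (negPf bj).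
move=> cs; have cs' : c ^+ 2 + (- s) ^+ 2 = 1 by rewrite sqrrN.
split; rewrite ?adj_givens ?key //; last by rewrite -{2}[s]opprK key.
move=> a b; rewrite mxE; do ![case: ifP => _]; rewrite ?mulr0n;
  try exact: in_scalars_real.
- by apply: in_scalarsM => //; exact: in_scalars_real.
- apply: in_scalarsN; apply: in_scalarsM; first exact: in_scalars_real.
  exact: in_scalars_conj.
- by case: eqP => _; exact: in_scalars_real.
Qed.

Variables (x : 'M[quat R]_n) (hx : in_H beta x) (c s : R) (e : quat R).
Hypothesis e1 : qnorm2 e = 1.
Let y := givens c s e *m x *m adjmx (givens c s e).
Let r := qre (x i j * qconj e).

(** Right multiplication by an adjoint becomes left multiplication on the adjoint, so [givens_mul]
    handles both sides. *)
Let yE a b : y a b = qconj ((givens c s e *m adjmx (givens c s e *m x)) b a).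
Proof. by rewrite -adjmxE adjmxM adjmxK. Qed.

Lemma givens_conj_diag a : qre (y a a) =
  if a == i then c ^+ 2 * qre (x i i) + s ^+ 2 * qre (x j j) + 2 * c * s * r
  else if a == j then
    s ^+ 2 * qre (x i i) + c ^+ 2 * qre (x j j) - 2 * c * s * r
  else qre (x a a).
Proof.
have ji : (j == i) = false by rewrite eq_sym (negPf ij).
rewrite yE givens_mul !adjmxE !givens_mul /r.
case: (eqVneq a i) => _.
  rewrite (in_HP i j hx) (in_H_diag i hx) (in_H_diag j hx).
  transitivity (c ^+ 2 * qre (x i i) + s ^+ 2 * qre (x j j) * qnorm2 e +
    2 * c * s * qre (x i j * qconj e)); last by rewrite e1 mulr1.
  by rewrite /qnorm2 /=; ring.
case: (eqVneq a j) => _ //.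
rewrite (in_HP i j hx) (in_H_diag i hx) (in_H_diag j hx).
transitivity (s ^+ 2 * qre (x i i) * qnorm2 e + c ^+ 2 * qre (x j j) -
  2 * c * s * qre (x i j * qconj e)); last by rewrite e1 mulr1.
by rewrite /qnorm2 /=; ring.
Qed.

Lemma givens_conj_offdiag : qre (y i j * qconj e) =
  (c ^+ 2 - s ^+ 2) * r + c * s * (qre (x j j) - qre (x i i)).
Proof.
have ji : (j == i) = false by rewrite eq_sym (negPf ij).
rewrite yE givens_mul !adjmxE !givens_mul !eqxx ji.
rewrite (in_HP i j hx) (in_H_diag i hx) (in_H_diag j hx) /r.
transitivity ((c ^+ 2 - s ^+ 2 * qnorm2 e) * qre (x i j * qconj e) +
  c * s * (qre (x j j) - qre (x i i)) * qnorm2 e); last by rewrite e1 !mulr1.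
by rewrite /qnorm2 /=; ring.
Qed.
End Givens.
End HermitianMatrixTheory.

(** * Entries of a trace-one projection *)

Section TraceOneProjections.
Variables (R : realType) (n beta : nat) (x : 'M[quat R]_n).
Hypothesis hx : trace_one_projection beta x.
Let xH : in_H beta x. Proof. by case: hx. Qed.
Let p i := qre (x i i).

Lemma projection_row i : \sum_k qnorm2 (x i k) = p i.
Proof.
have [_ xx _] := hx; rewrite /p -{2}xx mxE qre_sum; apply: eq_bigr => k _.
by rewrite (in_HP i k xH) mul_qconj.
Qed.

Lemma projection_trace : \sum_i p i = 1.
Proof. by have [_ _ /(congr1 (@qre R))] := hx; rewrite qre_sum. Qed.

Lemma projection_diag_ge0 i : 0 <= p i.
Proof. by rewrite -projection_row sumr_ge0 // => k _; exact: qnorm2_ge0. Qed.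

Lemma projection_diag_le1 i : p i <= 1.
Proof.
rewrite -projection_trace (bigD1 i) //= lerDl sumr_ge0 // => k _.
exact: projection_diag_ge0.
Qed.

Lemma projection_entry_le1 i j : qnorm2 (x i j) <= 1.
Proof.
apply: le_trans (projection_diag_le1 i); rewrite -projection_row.
rewrite (bigD1 j) //= lerDl sumr_ge0 // => k _; exact: qnorm2_ge0.
Qed.

(* By Cauchy-Schwarz each [p i * p j - qnorm2 (x i j)] is nonnegative, and these
   defects sum to [(tr x)^2 - tr (x^2) = 0]. *)
Lemma projection_rank_one i j : qnorm2 (x i j) = p i * p j.
Proof.
have sym a b : qnorm2 (x a b) = qnorm2 (x b a).
  by rewrite (in_HP b a xH) qnorm2_conj.
have col : \sum_a qnorm2 (x a j) = p j.
  by rewrite -projection_row; apply: eq_bigr => a _; rewrite sym.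
have cross a : \sum_k qre (x a k * x k j * qconj (x a j)) = qnorm2 (x a j).
  rewrite -qre_sum -mulr_suml; have [_ /matrixP /(_ a j) + _] := hx.
  by rewrite mxE => ->; rewrite mul_qconj.
have CS a : p j * (p a * p j - qnorm2 (x a j)) =
    \sum_k qnorm2 (qreal (p j) * x a k - x a j * x j k).
  transitivity (\sum_k (p j ^+ 2 * qnorm2 (x a k)
      + qnorm2 (x a j) * qnorm2 (x j k)
      - 2 * p j * qre (x a k * x k j * qconj (x a j)))).
    by rewrite sumrB big_split /= -!mulr_sumr !projection_row cross; ring.
  apply: eq_bigr => k _; rewrite (in_HP j k xH) /qnorm2 /=; ring.
have CS_ge0 a : 0 <= p j * (p a * p j - qnorm2 (x a j)).
  by rewrite CS sumr_ge0 // => k _; exact: qnorm2_ge0.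
have CS_sum : \sum_a p j * (p a * p j - qnorm2 (x a j)) = 0.
  by rewrite -mulr_sumr sumrB -mulr_suml projection_trace col mul1r subrr mulr0.
have := @psumr_eq0P _ _ xpredT _ (fun a _ => CS_ge0 a) CS_sum i isT.
move=> /eqP; rewrite mulf_eq0 => /orP[/eqP pj0|]; last by rewrite subr_eq0 => /eqP.
rewrite pj0 mulr0; move: col; rewrite pj0 => col.
exact: (@psumr_eq0P _ _ xpredT _ (fun a _ => qnorm2_ge0 (x a j)) col i isT).
Qed.
End TraceOneProjections.

(** * Continuity, tested on the four real coordinates *)

Section QuaternionContinuity.
Variables (R : realType) (n : nat) (T : topologicalType).

Definition qcontinuous (f : T -> quat R) :=
  forall c, qcomponent c -> continuous (fun v => c (f v)).

Lemma qcontinuousP f : continuous (fun v => qre (f v)) ->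
  continuous (fun v => qi (f v)) -> continuous (fun v => qj (f v)) ->
  continuous (fun v => qk (f v)) -> qcontinuous f.
Proof. by move=> h1 h2 h3 h4 c; case=> ->. Qed.

Lemma qcontinuous_cst q : qcontinuous (fun=> q).
Proof. by move=> c _; exact: (@cst_continuous _ _ (c q)). Qed.

Let qcontinuousE f : qcontinuous f ->
  [/\ continuous (fun v => qre (f v)), continuous (fun v => qi (f v)),
      continuous (fun v => qj (f v)) & continuous (fun v => qk (f v))].
Proof.
by move=> hf; split;
  [apply: (hf (@qre R))|apply: (hf (@qi R))|apply: (hf (@qj R))|apply: (hf (@qk R))];
  constructor.
Qed.

Let contD (a b : T -> R) : continuous a -> continuous b ->
  continuous (fun v => a v + b v).
Proof. by move=> ha hb v; exact: cvgD (ha v) (hb v). Qed.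
Let contB (a b : T -> R) : continuous a -> continuous b ->
  continuous (fun v => a v - b v).
Proof. by move=> ha hb v; exact: cvgB (ha v) (hb v). Qed.
Let contM (a b : T -> R) : continuous a -> continuous b ->
  continuous (fun v => a v * b v).
Proof. by move=> ha hb v; exact: cvgM (ha v) (hb v). Qed.

Lemma qcontinuousD f g :
  qcontinuous f -> qcontinuous g -> qcontinuous (fun v => f v + g v).
Proof.
move=> /qcontinuousE[f1 f2 f3 f4] /qcontinuousE[g1 g2 g3 g4].
apply: qcontinuousP.
- exact: contD f1 g1.
- exact: contD f2 g2.
- exact: contD f3 g3.
- exact: contD f4 g4.
Qed.

Lemma qcontinuous_conj f : qcontinuous f -> qcontinuous (fun v => qconj (f v)).
Proof.
move=> /qcontinuousE[f1 f2 f3 f4].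
by apply: qcontinuousP => v /=; first exact: f1; apply: cvgN;
  first [exact: f2|exact: f3|exact: f4].
Qed.

Lemma qcontinuousM f g :
  qcontinuous f -> qcontinuous g -> qcontinuous (fun v => f v * g v).
Proof.
move=> /qcontinuousE[f1 f2 f3 f4] /qcontinuousE[g1 g2 g3 g4].
apply: qcontinuousP.
- exact: contB (contB (contB (contM f1 g1) (contM f2 g2)) (contM f3 g3)) (contM f4 g4).
- exact: contB (contD (contD (contM f1 g2) (contM f2 g1)) (contM f3 g4)) (contM f4 g3).
- exact: contD (contD (contB (contM f1 g3) (contM f2 g4)) (contM f3 g1)) (contM f4 g2).
- exact: contD (contB (contD (contM f1 g4) (contM f2 g3)) (contM f3 g2)) (contM f4 g1).
Qed.

Lemma qcontinuous_sum (I : finType) (F : I -> T -> quat R) :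
  (forall i, qcontinuous (F i)) -> qcontinuous (fun v => \sum_i F i v).
Proof.
move=> hF; rewrite /index_enum; elim: (Finite.enum _) => [|i s IH].
  under [X in qcontinuous X]eq_fun do rewrite big_nil.
  exact: qcontinuous_cst.
under [X in qcontinuous X]eq_fun do rewrite big_cons.
exact: qcontinuousD.
Qed.

Definition mx_continuous (F : T -> 'M[quat R]_n) :=
  forall a b, qcontinuous (fun v => F v a b).

Lemma mx_continuousM F G :
  mx_continuous F -> mx_continuous G -> mx_continuous (fun v => F v *m G v).
Proof.
move=> hF hG a b; under [X in qcontinuous X]eq_fun do rewrite mxE.
by apply: qcontinuous_sum => k; exact: qcontinuousM.
Qed.

Lemma mx_continuous_adj F : mx_continuous F -> mx_continuous (fun v => adjmx (F v)).
Proof.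
move=> hF a b; under [X in qcontinuous X]eq_fun do rewrite adjmxE.
exact: qcontinuous_conj.
Qed.

End QuaternionContinuity.

(** * The spectral theorem over the three scalar algebras *)

Section SpectralTheorem.
Variables (R : realType) (n beta : nat).

(** Matrices are parametrised by their $4n^2$ real coordinates, so that compactness of the unitary
    group can be checked in $\mathbb{R}^m$ as closed and bounded. *)
Let m := #|{: 'I_n * 'I_n * 'I_4}|.
Let entry (v : 'rV[R]_m) a b (t : 'I_4) := v ord0 (enum_rank (a, b, t)).
Let mat (v : 'rV[R]_m) : 'M[quat R]_n :=
  \matrix_(a, b) Quat (entry v a b 0) (entry v a b 1) (entry v a b 2)
                      (entry v a b 3).

Let mx_continuous_mat : mx_continuous mat.
Proof.
move=> a b; under [X in qcontinuous X]eq_fun do rewrite mxE.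
by apply: qcontinuousP => /=; exact: coord_continuous.
Qed.

Let mat_surj U : exists v, mat v = U.
Proof.
pose comp (t : 'I_4) q : R :=
  if t == 0 then qre q else if t == 1 then qi q else if t == 2 then qj q
  else qk q.
exists (\row_k let t := enum_val k in comp t.2 (U t.1.1 t.1.2)).
apply/matrixP => a b; rewrite mxE /entry !mxE !enum_rankK /=.
by case: (U a b).
Qed.

Let closed_component (f : 'rV[R]_m -> quat R) (c : quat R -> R) r :
  qcontinuous f -> qcomponent c ->
  closed [set v | c (f v) = r].
Proof.
move=> hf hc; apply: (@preimage_closed _ _ (fun v => c (f v)) [set t | t = r]).
  by move=> v _; exact: hf.
exact: closed_eq.
Qed.

Let closed_qeq (f : 'rV[R]_m -> quat R) q : qcontinuous f -> closed [set v | f v = q].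
Proof.
move=> hf.
have -> : [set v | f v = q] =
   [set v | qre (f v) = qre q] `&` [set v | qi (f v) = qi q] `&`
   [set v | qj (f v) = qj q] `&` [set v | qk (f v) = qk q].
  apply/seteqP; split=> v /=; first by move=> ->.
  by move=> [[[h1 h2] h3] h4]; exact: quatP.
by do 3?apply: closedI; apply: closed_component => //; constructor.
Qed.

Let closed_mxeq (F : 'rV[R]_m -> 'M[quat R]_n) M :
  mx_continuous F -> closed [set v | F v = M].
Proof.
move=> hF; have -> : [set v | F v = M] =
    \bigcap_(ab in [set: 'I_n * 'I_n]) [set v | F v ab.1 ab.2 = M ab.1 ab.2].
  apply/seteqP; split=> v /=; first by move=> <-.
  by move=> h; apply/matrixP => a b; exact: (h (a, b)).
by apply: closed_bigI => -[a b] _; apply: closed_qeq.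
Qed.

Let closed_imply (b : bool) (A : set 'rV[R]_m) :
  closed A -> closed [set v | b -> A v].
Proof.
case: b => hA.
  by rewrite (_ : mkset _ = A) //; apply/seteqP; split => v //=; exact.
by rewrite (_ : mkset _ = setT) ?closedT //; apply/seteqP; split.
Qed.

Let closed_unitary : closed [set v | unitary beta (mat v)].
Proof.
have -> : [set v | unitary beta (mat v)] =
   (\bigcap_(ab in [set: 'I_n * 'I_n])
     ([set v | (beta < 2)%N -> qi (mat v ab.1 ab.2) = 0] `&`
      [set v | (beta < 4)%N -> qj (mat v ab.1 ab.2) = 0] `&`
      [set v | (beta < 4)%N -> qk (mat v ab.1 ab.2) = 0])) `&`
   [set v | mat v *m adjmx (mat v) = 1%:M] `&`
   [set v | adjmx (mat v) *m mat v = 1%:M].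
  apply/seteqP; split=> v /=.
    by move=> [h1 h2 h3]; split=> //; split=> // -[a b] _ /=; case: (h1 a b).
  move=> [[h1 h2] h3]; split=> // a b.
  by have /= [[]] := h1 (a, b) I.
apply: closedI; last first.
  apply: closed_mxeq; apply: mx_continuousM => //; exact: mx_continuous_adj.
apply: closedI; last first.
  apply: closed_mxeq; apply: mx_continuousM => //; exact: mx_continuous_adj.
apply: closed_bigI => -[a b] _ /=; do 2?apply: closedI; apply: closed_imply;
  apply: (closed_component (f := fun v => mat v a b)) => //; by constructor.
Qed.

(** Rows of a unitary matrix have norm 1, which confines every real coordinate to $[-1,1]$. *)
Let compact_unitary : compact [set v | unitary beta (mat v)].
Proof.
have box : compact [set v : 'rV[R]_m | forall k, v ord0 k \in `[(-1 : R), 1 : R]].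
  by apply: (@rV_compact R _ (fun=> `[(-1 : R), 1 : R]%classic)) => _;
    exact: segment_compact.
apply: subclosed_compact closed_unitary box _ => v hv k /=; rewrite in_itv /= -ler_norml.
have [[[a b] t] <-] : exists t, enum_rank t = k.
  by exists (enum_val k); rewrite enum_valK.
have : qnorm2 (mat v a b) <= 1.
  rewrite -(unitary_row a hv) (bigD1 b) //= lerDl sumr_ge0 // => c _.
  exact: qnorm2_ge0.
move=> h; rewrite -/(entry v a b t).
have : entry v a b t ^+ 2 <= 1.
  apply: le_trans h; rewrite mxE /qnorm2 /=.
  have : [\/ t = 0, t = 1, t = 2 | t = 3].
    by case: t => -[|[|[|[|//]]]] ?; constructor; apply: val_inj.
  case=> ->; nra.
by move=> h2; rewrite ler_norml; apply/andP; split; nra.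
Qed.

Let linear_dominates_quadratic (d A r : R) : d != 0 ->
  (forall t, d * (t ^+ 2 * A + 2 * t * r) <= 0) -> r = 0.
Proof.
move=> d0 h; have n0 := normr_ge0 (d * A).
(* This [t] has the sign of [d * r], and the denominator keeps the quadratic term at most half the
   linear one in absolute value; the remaining factor is therefore at least 1. *)
have := h (d * r / (1 + `|d * A|)).
have -> : d * ((d * r / (1 + `|d * A|)) ^+ 2 * A + 2 * (d * r / (1 + `|d * A|)) * r)
   = (d * r) ^+ 2 / (1 + `|d * A|) * (d * A / (1 + `|d * A|) + 2).
  by field; apply: lt0r_neq0; lra.
have h1 : -1 <= d * A / (1 + `|d * A|).
  by rewrite ler_pdivlMr; [have := ler_norm (- (d * A)); rewrite normrN; lra|lra].
rewrite pmulr_lle0; last lra.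
rewrite pmulr_lle0; last by rewrite invr_gt0; lra.
rewrite -[_ <= 0]/(_ <= 0) real_exprn_even_le0 ?num_real //= mulf_eq0 (negPf d0).
by move=> /eqP.
Qed.

(* A maximizer of [\sum_k k * qre (U^* x U)_kk] over the unitary group: rotating
   its (i, j)-plane changes this quantity to first order by a nonzero multiple
   of the (i, j) entry, so that entry vanishes. *)
Lemma spectral_theorem (x : 'M[quat R]_n) : beta \in [:: 1; 2; 4]%N ->
  in_H beta x -> exists l, is_spectrum beta x l.
Proof.
move=> hbeta hx.
pose Phi (U : 'M[quat R]_n) := \sum_(k < n) k%:R * qre ((adjmx U *m x *m U) k k).
have [U hU Umax] : exists2 U, unitary beta U &
    forall V, unitary beta V -> Phi V <= Phi U.
  have ne : [set v | unitary beta (mat v)] !=set0.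
    by have [v hv] := mat_surj 1%:M; exists v; rewrite /= hv; exact: unitary1.
  have cPhi : {within [set v | unitary beta (mat v)], continuous (Phi \o mat)}.
    apply: continuous_subspaceT.
    have hx' : mx_continuous (fun _ : 'rV[R]_m => x).
      by move=> a b; exact: qcontinuous_cst.
    have hm := mx_continuousM
      (mx_continuousM (mx_continuous_adj mx_continuous_mat) hx') mx_continuous_mat.
    have -> : Phi \o mat = fun v => qre (\sum_(k < n) qreal k%:R *
        (adjmx (mat v) *m x *m mat v) k k).
      apply/funext => v; rewrite qre_sum /=; apply: eq_bigr => k _.
      by rewrite !mul0r !subr0.
    have hq : qcontinuous (fun v => \sum_(k < n) qreal k%:R *
        (adjmx (mat v) *m x *m mat v) k k).
      by apply: qcontinuous_sum => k; apply: qcontinuousM => //;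
        exact: qcontinuous_cst.
    by apply: (hq (@qre R)); constructor.
  have [v] := compact_EVT_max ne compact_unitary cPhi.
  rewrite inE /= => hv vmax; exists (mat v) => // V hV.
  by have [w hw] := mat_surj V; rewrite -hw; apply: vmax; rewrite inE /= hw.
pose y := adjmx U *m x *m U.
have hy : in_H beta y.
  have -> : y = adjmx U *m x *m adjmx (adjmx U) by rewrite adjmxK.
  by apply: in_H_conj => //; exact: unitary_adj.
have offdiag i j : i != j -> y i j = 0.
  move=> ij; apply: qnorm2_eq0.
  have hyij : in_scalars beta (y i j) by case: hy.
  rewrite (qnorm2_units hbeta hyij) big_seq big1 // => e he.
  set r := qre _.
  have e1 := qunits_norm2 he.
  have ij0 : i%:R - j%:R != 0 :> R.
    by rewrite subr_eq0 eqr_nat; apply: contra_neq ij => /val_inj.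
  suff -> : r = 0 by rewrite expr0n.
  apply: (@linear_dominates_quadratic _ (qre (y j j) - qre (y i i)) _ ij0) => t.
  have t1 : 0 < 1 + t ^+ 2 by nra.
  (* [t] is the tangent of the rotation angle, [c] its cosine and [t * c] its sine; the change of
     [Phi] is then a quadratic polynomial in [t] times the positive factor [c ^+ 2]. *)
  pose c := (Num.sqrt (1 + t ^+ 2))^-1.
  have c2 : c ^+ 2 = (1 + t ^+ 2)^-1 by rewrite exprVn sqr_sqrtr // ltW.
  have cs : c ^+ 2 + (t * c) ^+ 2 = 1.
    by rewrite exprMn c2; field; exact: lt0r_neq0.
  have hW := givens_unitary ij (qunits_in_scalars hbeta he) e1 cs.
  set W := givens i j c (t * c) e in hW.
  have := Umax (U *m adjmx W) (unitaryM hU (unitary_adj hW)).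
  rewrite /Phi adjmxM adjmxK.
  have -> : W *m adjmx U *m x *m (U *m adjmx W) = W *m y *m adjmx W.
    by rewrite /y !mulmxA.
  rewrite -/y; have hdiag := givens_conj_diag ij hy c (t * c) e1.
  rewrite -subr_le0 -sumrB (bigD1 i) //= (bigD1 j) 1?eq_sym //= big1; last first.
    move=> k /andP[ki kj].
    by rewrite hdiag (negPf ki) (negPf kj) -mulrBr subrr mulr0.
  rewrite (hdiag i) (hdiag j) !eqxx [j == i]eq_sym (negPf ij) -/r.
  have -> : c ^+ 2 = 1 - (t * c) ^+ 2 by rewrite -cs addrK.
  move: (qre (y i i)) (qre (y j j)) => p q.
  set lhs := (X in X <= 0 -> _).
  have -> : lhs = (i%:R - j%:R) * (t ^+ 2 * (q - p) + 2 * t * r) * c ^+ 2.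
    by rewrite /lhs; ring.
  by rewrite c2 pmulr_lle0 // invr_gt0.
exists (\row_k qre (y k k)), U; split=> //.
have -> : diag_mx (map_mx (@qreal R) (\row_k qre (y k k))) = y.
  apply/matrixP => a b; rewrite [LHS]mxE; case: eqVneq => [->|ab] /=.
    by rewrite mulr1n [LHS]mxE [X in qreal X]mxE -(in_H_diag b hy).
  by rewrite mulr0n offdiag.
have [_ UU _] := hU.
by rewrite /y !mulmxA UU mul1mx.
Qed.
End SpectralTheorem.

(** * Measurability on the matrix space *)

Section MeasurableMatrixFunctions.
Variables (R : realType) (n : nat).
Implicit Types (f g : borel_mx R n -> quat R).

Definition qmeasurable f :=
  forall c, qcomponent c -> measurable_fun setT (fun x => c (f x)).

Let qmeasurableP f : measurable_fun setT (fun x => qre (f x)) ->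
  measurable_fun setT (fun x => qi (f x)) ->
  measurable_fun setT (fun x => qj (f x)) ->
  measurable_fun setT (fun x => qk (f x)) -> qmeasurable f.
Proof. by move=> h1 h2 h3 h4 c; case=> ->. Qed.

Let qmeasurableE f : qmeasurable f ->
  [/\ measurable_fun setT (fun x => qre (f x)),
      measurable_fun setT (fun x => qi (f x)),
      measurable_fun setT (fun x => qj (f x)) &
      measurable_fun setT (fun x => qk (f x))].
Proof.
by move=> hf; split;
  [apply: (hf (@qre R))|apply: (hf (@qi R))|apply: (hf (@qj R))|apply: (hf (@qk R))];
  constructor.
Qed.

Lemma qmeasurable_cst q : qmeasurable (fun=> q).
Proof. by move=> c _; exact: measurable_cst. Qed.

Lemma qmeasurableD f g :
  qmeasurable f -> qmeasurable g -> qmeasurable (fun x => f x + g x).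
Proof.
move=> /qmeasurableE[f1 f2 f3 f4] /qmeasurableE[g1 g2 g3 g4].
apply: qmeasurableP.
- exact: measurable_funD f1 g1.
- exact: measurable_funD f2 g2.
- exact: measurable_funD f3 g3.
- exact: measurable_funD f4 g4.
Qed.

Lemma qmeasurableM f g :
  qmeasurable f -> qmeasurable g -> qmeasurable (fun x => f x * g x).
Proof.
move=> /qmeasurableE[f1 f2 f3 f4] /qmeasurableE[g1 g2 g3 g4].
apply: qmeasurableP.
- exact: measurable_funB (measurable_funB (measurable_funB (measurable_funM f1 g1)
    (measurable_funM f2 g2)) (measurable_funM f3 g3)) (measurable_funM f4 g4).
- exact: measurable_funB (measurable_funD (measurable_funD (measurable_funM f1 g2)
    (measurable_funM f2 g1)) (measurable_funM f3 g4)) (measurable_funM f4 g3).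
- exact: measurable_funD (measurable_funD (measurable_funB (measurable_funM f1 g3)
    (measurable_funM f2 g4)) (measurable_funM f3 g1)) (measurable_funM f4 g2).
- exact: measurable_funD (measurable_funB (measurable_funD (measurable_funM f1 g4)
    (measurable_funM f2 g3)) (measurable_funM f3 g2)) (measurable_funM f4 g1).
Qed.

Lemma qmeasurable_sum (I : finType) (F : I -> borel_mx R n -> quat R) :
  (forall i, qmeasurable (F i)) -> qmeasurable (fun x => \sum_i F i x).
Proof.
move=> hF; rewrite /index_enum; elim: (Finite.enum _) => [|i s IH].
  under [X in qmeasurable X]eq_fun do rewrite big_nil.
  exact: qmeasurable_cst.
under [X in qmeasurable X]eq_fun do rewrite big_cons.
exact: qmeasurableD.
Qed.

Lemma measurable_entry i j : qmeasurable (fun x => x i j).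
Proof.
move=> c hc _ B mB; rewrite setTI.
by apply: sub_sigma_algebra; exists i, j, c, B; split.
Qed.

Lemma measurable_conj (V : 'M[quat R]_n) :
  measurable_fun setT
    (fun x : borel_mx R n => V *m x *m adjmx V : borel_mx R n).
Proof.
apply: (@measurability _ _ (borel_mx R n) (borel_mx R n) setT _
  (@mx_cylinders R n)) => //.
move=> _ [_ [i [j [c [B [hc mB ->]]]]] <-].
have hq : qmeasurable (fun x => (V *m x *m adjmx V) i j).
  under [X in qmeasurable X]eq_fun do rewrite mxE.
  apply: qmeasurable_sum => k; apply: qmeasurableM; last exact: qmeasurable_cst.
  under [X in qmeasurable X]eq_fun do rewrite mxE.
  apply: qmeasurable_sum => m; apply: qmeasurableM; first exact: qmeasurable_cst.
  exact: measurable_entry.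
exact: (hq c hc measurableT B mB).
Qed.
End MeasurableMatrixFunctions.

(** * Test functions for the moments *)

Section ProjectionFunctions.
Variables (R : realType) (n beta : nat).
Implicit Types (f g : borel_mx R n -> R).

(** Bounds are asked only on the values that [P1] can take; this gives integrability, and
    polynomials in the entries qualify. *)
Definition proj_bounded f := measurable_fun setT f /\
  exists M, forall x, trace_one_projection beta x -> `|f x| <= M.

Lemma proj_bounded_cst c : proj_bounded (fun=> c).
Proof. by split; [exact: measurable_cst | exists `|c|]. Qed.

Lemma proj_boundedD f g :
  proj_bounded f -> proj_bounded g -> proj_bounded (fun x => f x + g x).
Proof.
move=> [mf [M hM]] [mg [N hN]]; split; first exact: measurable_funD.
exists (M + N) => x hx; apply: le_trans (ler_normD _ _) _.
by apply: lerD; [exact: hM|exact: hN].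
Qed.

Lemma proj_boundedM f g :
  proj_bounded f -> proj_bounded g -> proj_bounded (fun x => f x * g x).
Proof.
move=> [mf [M hM]] [mg [N hN]]; split; first exact: measurable_funM.
by exists (M * N) => x hx; rewrite normrM ler_pM ?hM ?hN.
Qed.

Lemma proj_boundedZ c f : proj_bounded f -> proj_bounded (fun x => c * f x).
Proof. by apply: proj_boundedM; exact: proj_bounded_cst. Qed.

Lemma proj_boundedB f g :
  proj_bounded f -> proj_bounded g -> proj_bounded (fun x => f x - g x).
Proof.
move=> hf hg; under [X in proj_bounded X]eq_fun do rewrite -mulN1r.
by apply: proj_boundedD => //; exact: proj_boundedZ.
Qed.

Lemma proj_boundedX f k : proj_bounded f -> proj_bounded (fun x => f x ^+ k).
Proof.
move=> hf; elim: k => [|k IH].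
  under [X in proj_bounded X]eq_fun do rewrite expr0.
  exact: proj_bounded_cst.
under [X in proj_bounded X]eq_fun do rewrite exprS.
exact: proj_boundedM.
Qed.

Lemma proj_bounded_sum (I : Type) (s : seq I) (F : I -> borel_mx R n -> R) :
  (forall i, proj_bounded (F i)) -> proj_bounded (fun x => \sum_(i <- s) F i x).
Proof.
move=> hF; elim: s => [|i s IH].
  under [X in proj_bounded X]eq_fun do rewrite big_nil.
  exact: proj_bounded_cst.
under [X in proj_bounded X]eq_fun do rewrite big_cons.
exact: proj_boundedD.
Qed.

Lemma proj_bounded_entry q i j : proj_bounded (fun x => qre (x i j * q)).
Proof.
have hm : qmeasurable (fun x : borel_mx R n => x i j * q).
  by apply: qmeasurableM; [exact: measurable_entry|exact: qmeasurable_cst].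
split; first by apply: (hm (@qre R)); constructor.
(* From $r^2\le N$ follows $|r|\le N+1$, which avoids a square root. *)
exists (qnorm2 q + 1) => x hx.
have : qre (x i j * q) ^+ 2 <= qnorm2 q.
  apply: le_trans (qcomponent_le _ _) _; first by constructor.
  by rewrite qnorm2M ler_piMl ?qnorm2_ge0 // (projection_entry_le1 hx).
have := qnorm2_ge0 q; move: (qnorm2 q) (qre _) => N r N0 h.
by rewrite ler_norml; apply/andP; split; nra.
Qed.

Lemma proj_bounded_diag i : proj_bounded (fun x => qre (x i i)).
Proof.
under [X in proj_bounded X]eq_fun do rewrite -(mulr1 (_ i i)).
exact: proj_bounded_entry.
Qed.

Definition diag_form (l : 'I_n -> R) (x : 'M[quat R]_n) : R :=
  \sum_i l i * qre (x i i).

Lemma proj_bounded_form l : proj_bounded (diag_form l).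
Proof.
by apply: proj_bounded_sum => i; apply: proj_boundedZ; exact: proj_bounded_diag.
Qed.

Definition poly_bounded (p : borel_mx R n -> {poly R}) :=
  forall m, proj_bounded (fun x => (p x)`_m).

Lemma poly_bounded_cst p : poly_bounded (fun=> p).
Proof. by move=> m; exact: proj_bounded_cst. Qed.

Lemma poly_boundedM p q :
  poly_bounded p -> poly_bounded q -> poly_bounded (fun x => p x * q x).
Proof.
move=> hp hq m; under [X in proj_bounded X]eq_fun do rewrite coefM.
by apply: proj_bounded_sum => i; exact: proj_boundedM.
Qed.

Lemma poly_boundedX p k : poly_bounded p -> poly_bounded (fun x => p x ^+ k).
Proof.
move=> hp; elim: k => [|k IH].
  under [X in poly_bounded X]eq_fun do rewrite expr0.
  exact: poly_bounded_cst.
under [X in poly_bounded X]eq_fun do rewrite exprS.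
exact: poly_boundedM.
Qed.
End ProjectionFunctions.

(** The naturals below the size of [p - q] are too many distinct roots for it to be nonzero. *)
Lemma poly_eq_horner (R : realType) (p q : {poly R}) :
  (forall t, p.[t] = q.[t]) -> p = q.
Proof.
move=> h; apply/eqP; rewrite -subr_eq0; apply/eqP.
apply: (@roots_geq_poly_eq0 _ _ [seq i%:R | i <- iota 0 (size (p - q))]).
- by apply/allP => _ /mapP[i _ ->]; rewrite rootE !hornerE h subrr.
- by rewrite map_inj_uniq ?iota_uniq // => i j /eqP; rewrite eqr_nat => /eqP.
- by rewrite size_map size_iota.
Qed.

Section QuadraticPolynomials.
Variable R : realType.
Implicit Types (a b c t : R) (p q : {poly R}).

Definition quad a b c : {poly R} := Poly [:: a; b; c].

Lemma coef_quad a b c m : (quad a b c)`_m = nth 0 [:: a; b; c] m.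
Proof. exact: coef_Poly. Qed.

Lemma horner_quad a b c t : (quad a b c).[t] = a + b * t + c * t ^+ 2.
Proof. by rewrite horner_Poly /=; ring. Qed.

Lemma coef0M p q : (p * q)`_0 = p`_0 * q`_0.
Proof. by rewrite coefM big_ord_recl big_ord0 addr0. Qed.

Lemma coef1M p q : (p * q)`_1 = p`_0 * q`_1 + p`_1 * q`_0.
Proof. by rewrite coefM !big_ord_recl big_ord0 addr0. Qed.

Lemma coef0X p k : (p ^+ k)`_0 = p`_0 ^+ k.
Proof. by elim: k => [|k IH]; rewrite ?coef1 // !exprS coef0M IH. Qed.

Lemma coef1X p k : (p ^+ k)`_1 = k%:R * p`_0 ^+ k.-1 * p`_1.
Proof.
elim: k => [|k IH]; first by rewrite coef1 !mul0r.
rewrite exprS coef1M IH coef0X -natr1 /=.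
by case: k {IH} => [|k] /=; rewrite ?expr0 ?exprS; ring.
Qed.

Lemma size_quadMX a b c a' b' c' k :
  (size (quad a b c * quad a' b' c' ^+ k)%R <= k.*2 + 3)%N.
Proof.
have h1 : (size (quad a b c) <= 3)%N by exact: size_Poly.
have h2 : (size (quad a' b' c') <= 3)%N by exact: size_Poly.
have h3 := size_poly_exp_leq (quad a' b' c') k.
have h4 : ((size (quad a' b' c')).-1 * k <= 2 * k)%N by rewrite leq_mul2r; lia.
by apply: leq_trans (size_polyMleq _ _) _; lia.
Qed.
End QuadraticPolynomials.

(** * Moments of a diagonal form under the invariant law *)

Section Moments.
Variables (R : realType) (beta n : nat).
Hypothesis hbeta : beta \in [:: 1; 2; 4]%N.
Variables (d : measure_display) (T : measurableType d) (P : probability T R).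
Variable P1 : {mfun T >-> borel_mx R n}.
Hypothesis hproj : forall w, trace_one_projection beta (P1 w).
Hypothesis hinv : rotation_invariant beta (distribution P P1).
Implicit Types (f g : borel_mx R n -> R).

Local Notation proj_bounded := (@proj_bounded R n beta).
Local Notation poly_bounded := (@poly_bounded R n beta).

Definition mean f : R := \int[P]_w f (P1 w).

Lemma integrable_mean f :
  proj_bounded f -> P.-integrable setT (EFin \o (f \o P1)).
Proof.
move=> [mf [M hM]]; apply: measurable_bounded_integrable => //.
- by apply: le_lt_trans (ltry 1); exact: probability_le1.
- by apply: measurableT_comp.
- exists M; split; first exact: num_real.
  by move=> N MN w _; apply: le_trans (hM _ (hproj w)) (ltW MN).
Qed.

Lemma meanE f : proj_bounded f -> (\int[P]_w (f (P1 w))%:E = (mean f)%:E)%E.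
Proof.
move=> hf; rewrite /mean /Rintegral fineK //.
exact: integrable_fin_num (integrable_mean hf).
Qed.

Lemma eq_mean f g :
  (forall x, trace_one_projection beta x -> f x = g x) -> mean f = mean g.
Proof. by move=> fg; apply: eq_Rintegral => w _; exact/fg/hproj. Qed.

Lemma meanD f g : proj_bounded f -> proj_bounded g ->
  mean (fun x => f x + g x) = mean f + mean g.
Proof. by move=> hf hg; apply: RintegralD => //; exact: integrable_mean. Qed.

Lemma meanB f g : proj_bounded f -> proj_bounded g ->
  mean (fun x => f x - g x) = mean f - mean g.
Proof. by move=> hf hg; apply: RintegralB => //; exact: integrable_mean. Qed.

Lemma meanZ c f : proj_bounded f -> mean (fun x => c * f x) = c * mean f.
Proof. by move=> hf; apply: RintegralZl => //; exact: integrable_mean. Qed.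

Lemma mean_cst c : mean (fun=> c) = c.
Proof.
rewrite /mean Rintegral_cst // [X in fine X](_ : _ = 1%E) ?mulr1 //.
exact: probability_setT.
Qed.

Lemma mean_sum (I : Type) (s : seq I) (F : I -> borel_mx R n -> R) :
  (forall i, proj_bounded (F i)) ->
  mean (fun x => \sum_(i <- s) F i x) = \sum_(i <- s) mean (F i).
Proof.
move=> hF; elim: s => [|i s IH].
  under [X in mean X]eq_fun do rewrite big_nil.
  by rewrite big_nil mean_cst.
under [X in mean X]eq_fun do rewrite big_cons.
rewrite big_cons meanD ?IH //; exact: proj_bounded_sum.
Qed.

Lemma trace_one_projection_conj (V x : 'M[quat R]_n) : unitary beta V ->
  trace_one_projection beta x -> trace_one_projection beta (V *m x *m adjmx V).
Proof.
move=> hV [xH xx xt]; have [_ _ VV] := hV.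
have yH := in_H_conj hV xH; split=> //.
  rewrite !mulmxA -(mulmxA _ (adjmx V) V) VV mulmx1.
  by rewrite -(mulmxA V x x) xx.
(* The full trace is not cyclic over quaternions, but here it is real, and its real part [inner] is
   symmetric. *)
have -> : \tr (V *m x *m adjmx V) = qreal (inner (V *m x) (adjmx V)).
  rewrite /inner /mxtrace qre_sum qreal_sum.
  by apply: eq_bigr => i _; exact: in_H_diag yH.
by rewrite inner_mulC /inner mulmxA VV mul1mx xt.
Qed.

Lemma proj_bounded_conj (V : 'M[quat R]_n) f : unitary beta V ->
  proj_bounded f -> proj_bounded (fun x => f (V *m x *m adjmx V)).
Proof.
move=> hV [mf [M hM]]; split.
  exact: (measurableT_comp mf (measurable_conj V)).
by exists M => x hx; apply: hM; exact: trace_one_projection_conj.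
Qed.

(** Invariance concerns laws: both means are integrals of [f] against the distributions of [Y] and
    [P1], which agree on measurable sets. *)
Lemma mean_conj (V : 'M[quat R]_n) f : unitary beta V -> proj_bounded f ->
  mean (fun x => f (V *m x *m adjmx V)) = mean f.
Proof.
move=> hV hf; have mf : measurable_fun setT (EFin \o f).
  by apply/measurable_EFinP; case: hf.
pose Y w : borel_mx R n := V *m P1 w *m adjmx V.
have mY : measurable_fun setT Y.
  exact: measurableT_comp (measurable_conj V) _.
pose Ym : {mfun T >-> borel_mx R n} := HB.pack Y (isMeasurableFun.Build _ _ _ _ _ mY).
have iY : P.-integrable setT (EFin \o (f \o Y)).
  have [m [M hM]] := hf; apply: measurable_bounded_integrable => //.
  - by apply: le_lt_trans (ltry 1); exact: probability_le1.
  - exact: measurableT_comp.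
  - exists M; split; first exact: num_real.
    move=> N MN w _; apply: le_trans (hM _ _) (ltW MN).
    exact: trace_one_projection_conj.
congr fine.
have := @integral_distribution _ _ _ _ _ P Ym (EFin \o f) mf iY.
move=> /= <-.
have := @integral_distribution _ _ _ _ _ P P1 (EFin \o f) mf (integrable_mean hf).
move=> /= <-.
apply: eq_measure_integral => A mA _.
exact: (hinv hV mA).
Qed.

Lemma mean_poly (N : nat) (p : borel_mx R n -> {poly R}) t : poly_bounded p ->
  (forall x, (size (p x) <= N)%N) ->
  mean (fun x => (p x).[t]) = (\poly_(m < N) mean (fun x => (p x)`_m)).[t].
Proof.
move=> hp sp; rewrite horner_poly.
have -> : (fun x => (p x).[t]) = fun x => \sum_(m < N) t ^+ m * (p x)`_m.
  apply/funext => x; rewrite (horner_coef_wide _ (sp x)).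
  by apply: eq_bigr => m _; rewrite mulrC.
rewrite mean_sum => [|m]; last exact: proj_boundedZ.
by apply: eq_bigr => m _; rewrite meanZ 1?mulrC.
Qed.

(** Stands in for differentiating under the expectation: with a uniform degree bound the mean is
    itself a polynomial in [t], so equality for all [t] passes to coefficients. *)
Lemma mean_poly_coef (N : nat) (p q : borel_mx R n -> {poly R}) k :
  poly_bounded p -> poly_bounded q ->
  (forall x, (size (p x) <= N)%N) -> (forall x, (size (q x) <= N)%N) ->
  (forall t, mean (fun x => (p x).[t]) = mean (fun x => (q x).[t])) ->
  (k < N)%N -> mean (fun x => (p x)`_k) = mean (fun x => (q x)`_k).
Proof.
move=> hp hq sp sq h kN.
have /polyP /(_ k) : \poly_(m < N) mean (fun x => (p x)`_m) =
    \poly_(m < N) mean (fun x => (q x)`_m).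
  by apply: poly_eq_horner => t; rewrite -!mean_poly.
by rewrite !coef_poly kN.
Qed.

Variable l : 'I_n -> R.
Let X := diag_form l.
Let p i (x : borel_mx R n) := qre (x i i).
Let pX i k := mean (fun x => p i x * X x ^+ k).

Let hX k : proj_bounded (fun x => X x ^+ k).
Proof. by apply: proj_boundedX; exact: proj_bounded_form. Qed.
Let hp i : proj_bounded (p i).
Proof. exact: proj_bounded_diag. Qed.
Let hpX i k : proj_bounded (fun x => p i x * X x ^+ k).
Proof. exact: proj_boundedM. Qed.

Let poly_bounded_quad f g h : proj_bounded f -> proj_bounded g ->
  proj_bounded h -> poly_bounded (fun x => quad (f x) (g x) (h x)).
Proof.
move=> hf hg hh m; under [X in proj_bounded X]eq_fun do rewrite coef_quad.
by case: m => [|[|[|m]]] //=; rewrite ?nth_nil; exact: proj_bounded_cst.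
Qed.

(* Invariance under rotations of angle [atan t] in the (i, j)-plane makes a
   polynomial in [t] constant up to the factor [(1 + t^2)^(k + 1)]; the identity
   is its coefficient of degree 1. *)
Lemma mean_rotation i j (e : quat R) k : i != j -> e \in qunits R beta ->
  mean (fun x => (p j x - p i x) * X x ^+ k) =
  2 * (l j - l i) * k%:R *
    mean (fun x => qre (x i j * qconj e) ^+ 2 * X x ^+ k.-1).
Proof.
move=> ij he; have e1 := qunits_norm2 he; have es := qunits_in_scalars hbeta he.
pose r (x : borel_mx R n) := qre (x i j * qconj e).
pose q x := p j x - p i x.
pose D := l i - l j.
have hr : proj_bounded r by exact: proj_bounded_entry.
have hq : proj_bounded q by exact: proj_boundedB.
have hX1 : proj_bounded X by exact: proj_bounded_form.
(* To first order the rotation adds [t * q] to [r] and [2 * D * t * r] to [X], so the invariance of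
   [r * X ^+ k] links exactly the two wanted means. [G] and [H] are $(1+t^2)^{k+1}$ times the
   rotated and unrotated [f]. *)
pose f x := r x * X x ^+ k.
have hf : proj_bounded f by exact: proj_boundedM.
pose G x := quad (r x) (q x) (-1 * r x) *
  quad (X x) (2 * D * r x) (X x + D * q x) ^+ k.
pose H x := quad (f x) 0 (f x) * quad 1 0 1 ^+ k.
have c0 a : proj_bounded (fun=> a) by exact: proj_bounded_cst.
have hG : poly_bounded G.
  apply: poly_boundedM; first by apply: poly_bounded_quad => //; exact: proj_boundedZ.
  apply: poly_boundedX; apply: poly_bounded_quad => //; first exact: proj_boundedZ.
  by apply: proj_boundedD => //; exact: proj_boundedZ.
have hH : poly_bounded H.
  apply: poly_boundedM; first exact: poly_bounded_quad.
  by apply: poly_boundedX; exact: poly_bounded_cst.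
have GH t : mean (fun x => (G x).[t]) = mean (fun x => (H x).[t]).
  have t1 : 0 < 1 + t ^+ 2 by nra.
  pose c := (Num.sqrt (1 + t ^+ 2))^-1.
  have c2 : (1 + t ^+ 2) * c ^+ 2 = 1.
    by rewrite exprVn sqr_sqrtr ?(ltW t1) // divff // lt0r_neq0.
  have cs : c ^+ 2 + (t * c) ^+ 2 = 1 by rewrite -c2; ring.
  have hV := givens_unitary ij es e1 cs.
  set V := givens i j c (t * c) e in hV.
  transitivity (mean (fun x => (1 + t ^+ 2) ^+ k.+1 * f (V *m x *m adjmx V))).
    apply: eq_mean => x [xH _ _].
    have hdiag := givens_conj_diag ij xH c (t * c) e1.
    have XV : (1 + t ^+ 2) * X (V *m x *m adjmx V) =
        (1 + t ^+ 2) * X x + D * (t ^+ 2 * q x + 2 * t * r x).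
      have -> : X (V *m x *m adjmx V) =
          X x + D * ((t * c) ^+ 2 * q x + 2 * c * (t * c) * r x).
        apply/eqP; rewrite -subr_eq0 opprD addrA subr_eq0; apply/eqP.
        rewrite /X /diag_form -sumrB (bigD1 i) //= (bigD1 j) 1?eq_sym //= big1.
          rewrite (hdiag i) (hdiag j) !eqxx [j == i]eq_sym (negPf ij).
          have -> : c ^+ 2 = 1 - (t * c) ^+ 2 by rewrite -cs addrK.
          by rewrite /D /q /p -/(r x); ring.
        by move=> a /andP[ai aj]; rewrite hdiag (negPf ai) (negPf aj) subrr.
      rewrite mulrDr; congr (_ + _).
      transitivity ((1 + t ^+ 2) * c ^+ 2 * (D * (t ^+ 2 * q x + 2 * t * r x))).
        by ring.
      by rewrite c2 mul1r.
    have rV : (1 + t ^+ 2) * r (V *m x *m adjmx V) =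
        (1 - t ^+ 2) * r x + t * q x.
      rewrite /r (givens_conj_offdiag ij xH c (t * c) e1) -/(r x) -/(p j x) -/(p i x).
      rewrite -/(q x).
      transitivity ((1 + t ^+ 2) * c ^+ 2 * ((1 - t ^+ 2) * r x + t * q x)).
        by ring.
      by rewrite c2 mul1r.
    rewrite /f exprS mulrACA -exprMn XV rV hornerM horner_exp !horner_quad.
    by congr (_ * _ ^+ k); ring.
  have hfV : proj_bounded (fun x => f (V *m x *m adjmx V)).
    exact: proj_bounded_conj.
  rewrite meanZ // mean_conj // -meanZ //; apply: eq_mean => x _.
  by rewrite hornerM horner_exp !horner_quad exprS !mul0r !addr0 mul1r; ring.
have k3 : (1 < k.*2 + 3)%N by rewrite addn3.
have := mean_poly_coef hG hH (fun x => size_quadMX _ _ _ _ _ _ _)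
  (fun x => size_quadMX _ _ _ _ _ _ _) GH k3.
(* [H x] contains only even powers of [t]. *)
have -> : (fun x => (H x)`_1) = fun=> 0.
  by apply/funext => x; rewrite coef1M coef0X coef1X !coef_quad /=; ring.
have -> : (fun x => (G x)`_1) = fun x => q x * X x ^+ k +
    2 * D * k%:R * (r x ^+ 2 * X x ^+ k.-1).
  by apply/funext => x; rewrite coef1M coef0X coef1X !coef_quad /=; ring.
have hrX : proj_bounded (fun x => r x ^+ 2 * X x ^+ k.-1).
  by apply: proj_boundedM => //; exact: proj_boundedX.
rewrite mean_cst meanD; [|exact: proj_boundedM|exact: proj_boundedZ].
rewrite meanZ // => /eqP; rewrite addr_eq0 => /eqP ->.
by rewrite /D; ring.
Qed.

(** The origin of [beta]: the left side of [mean_rotation] is the same for all [beta] units, while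
    on the right the squared coordinates add up to the squared norm of the entry, which is
    [p i * p j] by rank one. *)
Lemma mean_rotation_sum i j k :
  beta%:R * mean (fun x => (p j x - p i x) * X x ^+ k) =
  2 * (l j - l i) * k%:R * mean (fun x => p i x * p j x * X x ^+ k.-1).
Proof.
case: (eqVneq i j) => [->|ij].
  rewrite subrr mulr0 !mul0r; under eq_fun do rewrite subrr mul0r.
  by rewrite mean_cst mulr0.
have hr e : proj_bounded (fun x => qre (x i j * qconj e) ^+ 2 * X x ^+ k.-1).
  by apply: proj_boundedM => //; apply: proj_boundedX; exact: proj_bounded_entry.
have -> : mean (fun x => p i x * p j x * X x ^+ k.-1) =
    mean (fun x => \sum_(e <- qunits R beta)
      qre (x i j * qconj e) ^+ 2 * X x ^+ k.-1).
  apply: eq_mean => x hx; rewrite -mulr_suml.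
  have xs : in_scalars beta (x i j) by case: hx => -[].
  by rewrite -(qnorm2_units hbeta xs) (projection_rank_one hx).
rewrite mean_sum // mulr_sumr -{1}(size_qunits R hbeta).
rewrite -sum1_size natr_sum mulr_suml !big_seq; apply: eq_bigr => e he.
by rewrite mul1r; exact: mean_rotation.
Qed.

Lemma mean_diag_form_recursion i k :
  ((n * beta)%:R / 2 + k%:R) * pX i k =
  beta%:R / 2 * mean (fun x => X x ^+ k) + k%:R * l i * pX i k.-1.
Proof.
have E1 : \sum_j mean (fun x => (p j x - p i x) * X x ^+ k) =
    mean (fun x => X x ^+ k) - n%:R * pX i k.
  rewrite -mean_sum => [|j]; last by apply: proj_boundedM => //; exact: proj_boundedB.
  rewrite /pX -meanZ // -meanB //; last exact: proj_boundedZ.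
  apply: eq_mean => x hx; rewrite -mulr_suml sumrB (projection_trace hx).
  by rewrite sumr_const card_ord -[_ *+ n]mulr_natl; ring.
have E2 : k%:R * \sum_j (l j - l i) * mean (fun x => p i x * p j x * X x ^+ k.-1) =
    k%:R * (pX i k - l i * pX i k.-1).
  (* The factor [k%:R] in [E2] matters: at [k = 0] the identity [X ^+ k.-1 * X = X ^+ k] fails, and
     both sides vanish instead. *)
  case: k {E1} => [|k]; first by rewrite !mul0r.
  congr (_ * _); under eq_bigr => j _.
    rewrite -meanZ; last by do 2?apply: proj_boundedM.
  over.
  rewrite -mean_sum => [|j]; last by apply: proj_boundedZ; do 2?apply: proj_boundedM.
  rewrite /pX -meanZ // -meanB //; last exact: proj_boundedZ.
  apply: eq_mean => x hx /=.
  transitivity (p i x * X x ^+ k * (X x - l i * \sum_j p j x)); last first.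
    by rewrite (projection_trace hx) exprS; ring.
  rewrite mulr_sumr -sumrB mulr_sumr; apply: eq_bigr => j _.
  by rewrite /p; ring.
have : beta%:R * \sum_j mean (fun x => (p j x - p i x) * X x ^+ k) =
   2 * (k%:R * \sum_j (l j - l i) * mean (fun x => p i x * p j x * X x ^+ k.-1)).
  rewrite !mulr_sumr; apply: eq_bigr => j _.
  by rewrite mean_rotation_sum; ring.
rewrite E1 E2 natrM => h; nra.
Qed.

Let b : R := beta%:R / 2.
Let nb : R := (n * beta)%:R / 2.

Lemma pochhammerS (x : R) k : pochhammer x k.+1 = pochhammer x k * (x + k%:R).
Proof. by rewrite /pochhammer big_ord_recr. Qed.

Lemma pochhammer_gt0 (x : R) k : 0 < x -> 0 < pochhammer x k.
Proof. by move=> x0; apply: prodr_gt0 => i _; rewrite ltr_wpDr. Qed.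

Lemma moment_partition_sum k :
  mean (fun x => X x ^+ k) * pochhammer nb k * inv_fact R k =
  partition_sum b (fun j => (-1) ^+ j * elem_sym l j.+1) k.
Proof.
pose m k := mean (fun x => X x ^+ k).
have f0 : inv_fact R 0 = 1 by rewrite /inv_fact invr1.
have p0 (x : R) : pochhammer x 0 = 1 by rewrite /pochhammer big_ord0.
have m0 : m 0%N = 1.
  by rewrite /m; under eq_fun do rewrite expr0; exact: mean_cst.
(* [y] carries one Pochhammer factor more than [x], which absorbs the coefficient [nb + k] of
   [pX i k] in the recursion. *)
apply: (recursion_solution (x := fun k => m k * pochhammer nb k * inv_fact R k)
  (y := fun i k => pX i k * pochhammer nb k.+1 * inv_fact R k)) => /=.
- by rewrite m0 p0 f0 !mulr1.
- move=> i; rewrite pochhammerS p0 f0 !mulr1 mul1r mulrC.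
  by rewrite mean_diag_form_recursion !mul0r addr0.
- move=> i j; rewrite (pochhammerS _ j.+1) -(inv_factS R j).
  have := mean_diag_form_recursion i j.+1; rewrite /= -/nb -/b -/(m _) => h.
  transitivity ((nb + j.+1%:R) * pX i j.+1 * pochhammer nb j.+1 * inv_fact R j.+1).
    by ring.
  by rewrite h; ring.
- move=> j; rewrite [LHS]mulrCA inv_factS.
  under eq_bigr do rewrite !mulrA.
  rewrite -!mulr_suml; congr (_ * _ * _).
  under eq_bigr do rewrite -meanZ //.
  rewrite -mean_sum => [|i]; last exact: proj_boundedZ.
  apply: eq_mean => x _; rewrite exprS {1}/X /diag_form mulr_suml.
  by apply: eq_bigr => i _; rewrite mulrA.
Qed.

Lemma proj_bounded_expR : proj_bounded (fun x => expR (X x)).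
Proof.
have [mX [M hM]] := proj_bounded_form beta l.
split; first exact: measurableT_comp.
exists (expR M) => x hx; rewrite ger0_norm ?expR_ge0 // ler_expR.
by apply: le_trans (ler_norm _) _; exact: hM.
Qed.

Lemma mean_exp_series :
  series (fun k => mean (fun x => X x ^+ k) / k`!%:R) @ \oo -->
  mean (fun x => expR (X x)).
Proof.
have [mX [M hM]] := proj_bounded_form beta l.
have hpart N : proj_bounded (fun x => series (exp_coeff (X x)) N).
  apply: proj_bounded_sum => k; under eq_fun do rewrite /exp_coeff /= mulrC.
  exact: proj_boundedZ.
(* Absolute values give a partial sum of the increasing series of $e^{|X|}$, with $|X|\le M$; the
   constant $e^M$ is the dominating function. *)
have hle N w : `|series (exp_coeff (X (P1 w))) N| <= expR M.
  have h0 : 0 <= `|X (P1 w)| by [].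
  apply: le_trans (_ : expR `|X (P1 w)| <= _); last by rewrite ler_expR; exact: hM.
  apply: (le_trans (ler_norm_sum _ _ _)).
  rewrite (eq_bigr (exp_coeff `|X (P1 w)|)) => [|k _]; last first.
    by rewrite /exp_coeff /= normrM normrX normfV normr_nat.
  apply: (@nondecreasing_cvgn_le R (series (exp_coeff `|X (P1 w)|))).
    by apply: nondecreasing_series => k _ _; exact: exp_coeff_ge0.
  exact: is_cvg_series_exp_coeff.
have hexp := proj_bounded_expR.
have cv : {ae P, forall w, [set: T] w ->
    (series (exp_coeff (X (P1 w))) N)%:E @[N --> \oo] --> (expR (X (P1 w)))%:E}.
  apply: aeW => w _; apply/fine_cvgP; split; first exact: nearW.
  exact: is_cvg_series_exp_coeff.
have dom : {ae P, forall w N, [set: T] w ->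
    (`|(series (exp_coeff (X (P1 w))) N)%:E| <= (expR M)%:E)%E}.
  by apply: aeW => w N _; rewrite abse_EFin lee_fin.
have ig : P.-integrable setT (fun=> (expR M)%:E).
  exact: (integrable_mean (proj_bounded_cst _ _ _)).
have [_ _] := dominated_convergence measurableT
  (fun N => measurable_int _ (integrable_mean (hpart N)))
  (measurable_int _ (integrable_mean hexp)) cv ig dom.
rewrite [X in _ --> X](_ : _ = (mean (fun x => expR (X x)))%:E); last exact: meanE.
have -> : [sequence \int[P]_w (EFin \o ((fun x => series (exp_coeff (X x)) N) \o P1)) w]_N%E
   = (fun N => (series (fun k => mean (fun x => X x ^+ k) / k`!%:R) N)%:E).
  apply/funext => N; rewrite [LHS](meanE (hpart N)); congr EFin.
  rewrite mean_sum => [|k].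
    apply: eq_bigr => k _; rewrite mulrC -meanZ //; apply: eq_mean => x _.
    by rewrite /exp_coeff /= mulrC.
  by under eq_fun do rewrite /exp_coeff /= mulrC; exact: proj_boundedZ.
by move=> /fine_cvgP[].
Qed.

End Moments.

(** * From the moments to the stated expansion *)

Lemma inner_sum_partition_sum (R : realType) (n beta k : nat)
    (theta : 'M[quat R]_n) :
  (-1) ^+ k * inner_sum beta k theta = partition_sum (beta%:R / 2)
    (fun j => (-1) ^+ j * elem_sym (fun i => eigenvalues beta theta 0 i) j.+1) k.
Proof.
rewrite /inner_sum /partition_sum mulr_sumr; apply: eq_bigr => nu /eqP hk.
have -> : \prod_(i < k) (inv_fact R (nu i) * ((-1) ^+ i *
    elem_sym (fun i => eigenvalues beta theta 0 i) i.+1) ^+ nu i) =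
  (-1) ^+ (\sum_(i < k) i * nu i) / \prod_(i < k) ((nu i)`!)%:R *
  \prod_(i < k) sigma beta i.+1 theta ^+ nu i.
  rewrite expr_sum -prodfV -!big_split /=; apply: eq_bigr => i _.
  by rewrite exprMn -exprM mulrA [_ * inv_fact _ _]mulrC.
(* With [i] counted from 0, $k=\sum_i i\nu_i+\sum_i\nu_i$: the first part gives the signs inside
   [a], the second cancels the sign $(-1)^m$ of [inner_sum]. *)
have -> : (-1) ^+ k = (-1) ^+ (\sum_(i < k) i * nu i) *
    (-1) ^+ (\sum_(i < k) nu i) :> R.
  rewrite -exprD -big_split /= -{1}hk; congr (_ ^+ _).
  by apply: eq_bigr => i _; rewrite mulSnr.
set m := (\sum_(i < k) nu i)%N.
have s2 : (-1) ^+ m * (-1) ^+ m = 1 :> R by rewrite -expr2 sqrr_sign.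
set A := (-1) ^+ (\sum_(i < k) _); set B := (\prod_(i < k) _)^-1.
set C := \prod_(i < k) _; set D := pochhammer _ _.
transitivity ((-1) ^+ m * (-1) ^+ m * (A * D * B * C)); first by ring.
by rewrite s2; ring.
Qed.

Lemma eigenvalues_spectrum (R : realType) (n beta : nat) (x : 'M[quat R]_n) :
  beta \in [:: 1; 2; 4]%N -> in_H beta x ->
  is_spectrum beta x (eigenvalues beta x).
Proof. by move=> hb hx; apply: xgetPex; exact: spectral_theorem. Qed.

(** Diagonalising the first argument moves the conjugation onto the second, by symmetry of [inner];
    invariance then removes it from the random projection. *)
Lemma inner_spectrum (R : realType) (n : nat) (U x y : 'M[quat R]_n)
    (l : 'rV[R]_n) : U *m adjmx U = 1%:M ->
  x *m U = U *m diag_mx (map_mx (@qreal R) l) ->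
  inner x y = diag_form (fun i => l 0 i) (adjmx U *m y *m U).
Proof.
move=> UU xU.
have -> : x = U *m (diag_mx (map_mx (@qreal R) l) *m adjmx U).
  by rewrite mulmxA -xU -mulmxA UU mulmx1.
transitivity (inner (diag_mx (map_mx (@qreal R) l)) (adjmx U *m y *m U)).
  rewrite /inner -(mulmxA U) -/(inner U _) inner_mulC /inner.
  by rewrite !mulmxA.
rewrite /inner /mxtrace qre_sum; apply: eq_bigr => i _.
by rewrite mul_diag_mx !mxE /= !mul0r !subr0.
Qed.

Theorem proposition6p3 (R : realType) (beta n : nat)
    (hbeta : beta \in [:: 1; 2; 4]%N) (hn : (0 < n)%N)
    (d : measure_display) (T : measurableType d) (P : probability T R)
    (P1 : {mfun T >-> borel_mx R n})
    (hproj : forall w : T, trace_one_projection beta (P1 w))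
    (hinv : rotation_invariant beta (distribution P P1))
    (theta : 'M[quat R]_n) (htheta : in_H beta theta) :
  cvgn (series (expansion_term beta theta)) /\
  ('E_P[fun w : T => expR (inner theta (P1 w))] =
    (limn (series (expansion_term beta theta)))%:E)%E.
Proof.
pose l i := eigenvalues beta theta 0 i.
have [U [hU thetaU]] := eigenvalues_spectrum hbeta htheta.
have [_ UU _] := hU.
have hV := unitary_adj hU.
have hf := proj_bounded_expR beta l.
have hfV := proj_bounded_conj hV hf.
have termE : expansion_term beta theta =
    (fun k => mean P P1 (fun x => diag_form l x ^+ k) / k`!%:R).
  apply/funext => k; rewrite /expansion_term mulrAC.
  rewrite inner_sum_partition_sum -(moment_partition_sum hbeta hproj hinv).
  (* The Pochhammer symbol can be cancelled because [n] and [beta] are positive, hence so are all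
     its factors. *)
  rewrite mulrAC mulfK // lt0r_neq0 // pochhammer_gt0 //.
  by rewrite divr_gt0 // ltr0n muln_gt0 hn; case: (beta) hbeta.
have cvS : series (expansion_term beta theta) @ \oo -->
    mean P P1 (fun x => expR (diag_form l x)).
  by rewrite termE; exact (@mean_exp_series R beta n d T P P1 hproj l).
have limS := cvg_lim (@Rhausdorff R) cvS.
split; first by apply/cvg_ex; eexists; exact: cvS.
rewrite limS -(mean_conj hproj hinv hV hf) -(meanE P hproj hfV) unlock.
apply: eq_integral => w _; congr (expR _)%:E.
by rewrite (inner_spectrum _ UU thetaU) adjmxK.
Qed.
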